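(* Let $n\ge1$ and let $f\in\mathcal R^0(\mathbb R^n)$ be non-negative on $\mathbb R^n$. Then there exist $f_1,\dots,f_m\in\mathcal R^0(\mathbb R^n)$ such that $f=\sum_{i=1}^m f_i^2$.
   Context: $\mathcal R^0(\mathbb R^n)$ denotes the ring of regulous functions: continuous functions $f:\mathbb R^n\to\mathbb R$ for which there exist a nonempty Zariski open set $U\subseteq\mathbb R^n$ and polynomials $p,q$ with $q$ nonvanishing on $U$ and $f=p/q$ on $U$. *)

(* Defs.v *)
From Stdlib Require Import Reals List.
From Stdlib Require Vectors.Fin.
Open Scope R_scope.

Definition Rn (n : nat) : Type := Fin.t n -> R.

Inductive Poly (n : nat) : Type :=
| PConst : R -> Poly n
| PVar : Fin.t n -> Poly n
| PAdd : Poly n -> Poly n -> Poly n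
| PMul : Poly n -> Poly n -> Poly n.
Arguments PConst {n}. Arguments PVar {n}. Arguments PAdd {n}. Arguments PMul {n}.

Fixpoint peval {n : nat} (p : Poly n) (x : Rn n) : R :=
  match p with
  | PConst c => c
  | PVar i => x i
  | PAdd p1 p2 => peval p1 x + peval p2 x
  | PMul p1 p2 => peval p1 x * peval p2 x
  end.

(* Zariski open set: complement of the common zero set of finitely many
   polynomials (every real algebraic set is of this form by Hilbert's basis theorem). *)
Definition zariski_open_of {n : nat} (S : list (Poly n)) (x : Rn n) : Prop :=
  ~ (forall g, In g S -> peval g x = 0).

Definition continuous_Rn {n : nat} (f : Rn n -> R) : Prop :=
  forall x eps, 0 < eps -> exists delta, 0 < delta /\
    forall y, (forall i, Rabs (y i - x i) < delta) -> Rabs (f y - f x) < eps.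

Definition regulous {n : nat} (f : Rn n -> R) : Prop :=
  continuous_Rn f /\
  exists (S : list (Poly n)) (p q : Poly n),
    (exists x0, zariski_open_of S x0) /\
    (forall x, zariski_open_of S x -> peval q x <> 0 /\ f x = peval p x / peval q x).

Fixpoint sum_sq {n : nat} (fs : list (Rn n -> R)) (x : Rn n) : R :=
  match fs with
  | nil => 0
  | g :: gs => (g x) ^ 2 + sum_sq gs x
  end.

(* Main.v *)
(** Writing f = p/q and expanding q along the segment from z to a point x0 with
    q(x0) <> 0 gives polynomials q_j(z), with p_j(z) for p.  By continuity
    f(z) q_j(z) = p_j(z) as soon as q_i(z) = 0 for all i < j; so f is rational on the
    strata where q_j is the first nonzero coefficient, and these strata cover R^n.
    By the Lojasiewicz inequality some power of f q_j - p_j is divisible by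
    sum_(i < j) q_i^2 in the ring of functions that are regulous on {f > 0}.

    If -1 = s - f t there, with s and t sums of squares, then f = (1 + s) t / t^2 on
    {f > 0}, and the resulting squares extend continuously by 0 because each of them
    is at most f.  Otherwise the functions s - f t form a proper preorder, which
    becomes nonnegative in some real closed field K, where f < 0.  The divisibilities
    force f q_j = p_j in K for the first j with q_j <> 0, so p_j q_j < 0 there, and
    by Tarski transfer also at some real point of the corresponding stratum, where
    f would be negative. *)
Require Import Defs.
From Stdlib Require Import Reals List.
From Stdlib Require Vectors.Fin.
From HB Require Import structures.
From mathcomp Require Import all_boot all_order all_algebra.
From mathcomp Require Import boolp classical_sets.
From mathcomp Require Import closed_field ring_quotient fraction.
From mathcomp Require Import reals topology normedtype Rstruct Rstruct_topology.
From mathcomp Require Import polyrcf ring lra zify.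
Set Implicit Arguments. Unset Strict Implicit. Unset Printing Implicit Defensive.
Import Order.TTheory GRing.Theory Num.Theory numFieldNormedType.Exports.
Import Defs.
Open Scope R_scope.
Local Open Scope classical_set_scope.
Local Open Scope ring_scope.

(** * Real closed extensions *)

(** The identity f q = p survives in K, but it says nothing about f there when q becomes 0. That f
    q_j - p_j vanishes on a stratum is a statement about points, which a homomorphism into K need
    not respect; that one of its powers is divisible by sum_(i < j) q_i^2 is a ring identity, which
    it does respect. The sum of all q_j is the nonzero constant q(x0), so some q_j is nonzero in K.
    That f is negative in K, and not merely non-positive, comes from inverting f. This is why
    functions on {f > 0} are used, and the price is that the squares in the certificate must be
    extended across the zeros of f. *)

Record precone (A : comNzRingType) (T : set A) : Prop := Precone {
  preconeD : forall a b, T a -> T b -> T (a + b);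
  preconeM : forall a b, T a -> T b -> T (a * b);
  precone_sqr : forall a, T (a * a);
  preconeN1 : ~ T (-1) }.

(** These are the points of the real spectrum of A: orderings of the residue fields at prime
    ideals. *)
Record prime_cone (A : comNzRingType) (P : set A) : Prop := PrimeCone {
  prime_precone : precone P;
  prime_total : forall a, P a \/ P (- a);
  prime_supp : forall a b, P (a * b) -> P (- (a * b)) ->
    (P a /\ P (- a)) \/ (P b /\ P (- b)) }.

(** Zorn's lemma is applied to the sets X whose union with X0 satisfies P; the empty chain, which
    the second hypothesis leaves out, is then covered by X0 itself. *)
Lemma Zorn_above (T : Type) (P : set (set T)) (X0 : set T) : P X0 ->
  (forall F : set (set T), F `<=` P -> F !=set0 -> total_on F subset ->
    P (\bigcup_(X in F) X)) ->
  exists M, [/\ X0 `<=` M, P M & forall X, M `<=` X -> P X -> X `<=` M].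
Proof.
move=> PX0 chain; pose Q X := P (X0 `|` X).
have [F QF totF|M [QM maxM]] := @Zorn_bigcup T Q.
  have [->|F0] := eqVneq F set0; first by rewrite /Q bigcup_set0 setU0.
  have -> : Q (\bigcup_(X in F) X) = P (\bigcup_(X in [set X0 `|` Y | Y in F]) X).
    rewrite /Q; congr P; apply/seteqP; split=> x.
      case=> [X0x|[X FX Xx]]; last by exists (X0 `|` X); [exists X|right].
      by have /set0P[X FX] := F0; exists (X0 `|` X); [exists X|left].
    by case=> _ [X FX <-] [X0x|Xx]; [left|right; exists X].
  apply: chain.
  - by move=> _ [X FX <-]; exact: QF.
  - by have /set0P[X FX] := F0; exists (X0 `|` X); exists X.
  - move=> _ _ [X FX <-] [Y FY <-].
    by have [XY|YX] := totF _ _ FX FY; [left|right]; exact: setUS.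
exists (X0 `|` M); split=> // X MX PX.
apply: contrapT => NXM; apply: (maxM X).
  split; first by move=> x Mx; apply: MX; right.
  by move=> XM; apply: NXM => x /XM; right.
rewrite /Q; suff -> : X0 `|` X = X by [].
by apply/seteqP; split=> x; [case=> // X0x; apply: MX; left|right].
Qed.

Lemma chain_mem2 (T : Type) (F : set (set T)) a b : total_on F subset ->
  (\bigcup_(X in F) X) a -> (\bigcup_(X in F) X) b -> exists X, [/\ F X, X a & X b].
Proof.
move=> totF [X FX Xa] [Y FY Yb].
by have [XY|YX] := totF _ _ FX FY; [exists Y|exists X]; split => //; [apply: XY|apply: YX].
Qed.

(** A maximal precone P is prime. If P misses x, then P + x P contains -1; two such identities, for
    a and -a or for two factors of an element of the support, multiply to put -1 into P. *)
Lemma precone_extend (A : comNzRingType) (T : set A) :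
  precone T -> exists P, T `<=` P /\ prime_cone P.
Proof.
move=> preT; have [F preF [X0 FX0] totF|P [TP preP maxP]] := Zorn_above preT.
  split.
  - move=> a b Fa Fb; have [X [FX Xa Xb]] := chain_mem2 totF Fa Fb.
    by exists X => //; exact: (preconeD (preF _ FX)).
  - move=> a b Fa Fb; have [X [FX Xa Xb]] := chain_mem2 totF Fa Fb.
    by exists X => //; exact: (preconeM (preF _ FX)).
  - by move=> a; exists X0 => //; exact: (precone_sqr (preF _ FX0)).
  - by move=> [X FX]; exact: (preconeN1 (preF _ FX)).
have [PD PM Psqr PN1] := preP.
have P0 : P 0 by rewrite -(mul0r 0); exact: Psqr.
have P1 : P 1 by rewrite -(mul1r 1); exact: Psqr.
have ext x : ~ P x -> exists s t, [/\ P s, P t & -1 = s + x * t].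
  move=> NPx; apply: contrapT => H.
  pose X := [set y | exists s t, [/\ P s, P t & y = s + x * t]].
  have PX y : P y -> X y by move=> Py; exists y, 0; split => //; rewrite mulr0 addr0.
  apply: NPx; apply: (maxP X) => //; last first.
    by exists 0, 1; split => //; rewrite mulr1 add0r.
  split => //.
  - move=> a b [s [t [Ps Pt ->]]] [s' [t' [Ps' Pt' ->]]].
    exists (s + s'), (t + t'); split; [exact: PD|exact: PD|ring].
  - move=> a b [s [t [Ps Pt ->]]] [s' [t' [Ps' Pt' ->]]].
    exists (s * s' + x * x * (t * t')), (s * t' + s' * t); split; last ring.
      by apply: (PD); [apply: (PM)|apply: (PM); [exact: Psqr|apply: (PM)]].
    by apply: (PD); apply: (PM).
  - by move=> a; apply: PX; exact: Psqr.
exists P; split => //.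
have tot a : P a \/ P (- a).
  apply: contrapT => /not_orP[/ext[s [t [Ps Pt E]]] /ext[s' [t' [Ps' Pt' E']]]].
  apply: PN1.
  have -> : -1 = s + s' + s * s' + a * a * (t * t').
    have : (1 + s) * (1 + s') = - (a * a * (t * t')).
      have -> : 1 + s = - (a * t) by rewrite -[1]opprK E; ring.
      have -> : 1 + s' = a * t' by rewrite -[1]opprK E'; ring.
      ring.
    by move=> H; rewrite -[a * a * _]opprK -H; ring.
  by apply: (PD); [apply: (PD); [apply: (PD)|apply: (PM)]|apply: (PM); [exact: Psqr|apply: (PM)]].
split => // a b Pab PNab.
have step x y : P (x * y) -> P (- (x * y)) -> ~ P x -> ~ P y -> False.
  move=> Pxy PNxy /ext[s [t [Ps Pt E]]] /ext[s' [t' [Ps' Pt' E']]].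
  apply: PN1.
  have -> : -1 = s + s' + s * s' + (- (x * y)) * (t * t').
    have : (1 + s) * (1 + s') = (x * y) * (t * t').
      have -> : 1 + s = - (x * t) by rewrite -[1]opprK E; ring.
      have -> : 1 + s' = - (y * t') by rewrite -[1]opprK E'; ring.
      ring.
    by move=> H; rewrite mulNr -H; ring.
  by apply: (PD); [apply: (PD); [apply: (PD)|apply: (PM)]|apply: (PM) => //; apply: (PM)].
apply: contrapT => /not_orP[/not_andP Na /not_andP Nb].
by case: Na => [Na|Na]; case: Nb => [Nb|Nb]; [apply: (step a b)|apply: (step a (- b))|apply: (step (- a) b)|apply: (step (- a) (- b))];
  rewrite ?mulrN ?mulNr ?opprK.
Qed.

(** The non-negative part C of an ordered subfield of L, the subfield being the union of C and -C;
    [fcB] closes it under subtraction. Since C determines both the subfield and its order, Zorn's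
    lemma can enlarge the two together. *)
Record field_cone (L : fieldType) := FieldCone {
  fc_set :> L -> Prop;
  fc1 : fc_set 1;
  fcD : forall x y, fc_set x -> fc_set y -> fc_set (x + y);
  fcM : forall x y, fc_set x -> fc_set y -> fc_set (x * y);
  fcV : forall x, fc_set x -> fc_set x^-1;
  fcB : forall x y, fc_set x -> fc_set y -> fc_set (x - y) \/ fc_set (y - x);
  fc_anti : forall x, fc_set x -> fc_set (- x) -> x = 0 }.

Section FieldConeType.
Variables (L : fieldType) (C : field_cone L).

Definition fc_pred : pred L := fun x => `[< C x \/ C (- x) >].

Lemma fc_divring_closed : divring_closed fc_pred.
Proof.
split; first by apply/asboolP; left; exact: fc1.
- have H x y : C x -> C y -> C (x - y) \/ C (- (x - y)) by rewrite opprB; exact: fcB.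
  move=> x y /asboolP Hx /asboolP Hy; apply/asboolP.
  case: Hx => Hx; case: Hy => Hy.
  + exact: H.
  + by left; exact: fcD.
  + by right; rewrite opprB addrC; apply: fcD.
  + by have [] := H _ _ Hx Hy; rewrite opprK addrC -opprB; rewrite ?opprK; [right|left];
      rewrite // opprK.
- move=> x y /asboolP Hx /asboolP Hy; apply/asboolP.
  case: Hx => Hx; case: Hy => /fcV Hy.
  + by left; exact: fcM.
  + by right; rewrite -mulrN -invrN; exact: fcM.
  + by right; rewrite -mulNr; exact: fcM.
  + by left; rewrite -mulrNN -invrN; exact: fcM.
Qed.

HB.instance Definition _ := GRing.isDivringClosed.Build L fc_pred fc_divring_closed.

Record fc_type := FcType { fc_val : L; fc_valP : fc_val \in fc_pred }.

HB.instance Definition _ := [isSub for fc_val].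
HB.instance Definition _ := [Choice of fc_type by <:].
HB.instance Definition _ := [SubChoice_isSubIntegralDomain of fc_type by <:].
HB.instance Definition _ := [SubIntegralDomain_isSubField of fc_type by <:].

Implicit Types x y : fc_type.
Definition fc_ge0 x : bool := `[< C (val x) >].
Definition fc_le x y := fc_ge0 (y - x).
Definition fc_lt x y := (y != x) && fc_le x y.
Definition fc_norm x := if fc_ge0 x then x else - x.

Lemma fc_ge0P x : reflect (C (val x)) (fc_ge0 x). Proof. exact: asboolP. Qed.

Lemma fc_le0 x : fc_le 0 x = fc_ge0 x. Proof. by rewrite /fc_le subr0. Qed.
Lemma fc_le0r x : fc_le x 0 = fc_ge0 (- x). Proof. by rewrite /fc_le sub0r. Qed.

Lemma fc_le0_add x y : fc_le 0 x -> fc_le 0 y -> fc_le 0 (x + y).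
Proof. by rewrite !fc_le0 => /fc_ge0P Hx /fc_ge0P Hy; apply/fc_ge0P; rewrite rmorphD; exact: fcD. Qed.
Lemma fc_le0_mul x y : fc_le 0 x -> fc_le 0 y -> fc_le 0 (x * y).
Proof. by rewrite !fc_le0 => /fc_ge0P Hx /fc_ge0P Hy; apply/fc_ge0P; rewrite rmorphM; exact: fcM. Qed.
Lemma fc_le0_anti x : fc_le 0 x -> fc_le x 0 -> x = 0.
Proof.
rewrite fc_le0 fc_le0r => /fc_ge0P Hx /fc_ge0P; rewrite rmorphN => Hnx.
by apply: val_inj; rewrite (fc_anti Hx Hnx) rmorph0.
Qed.
Lemma fc_sub_ge0 x y : fc_le 0 (y - x) = fc_le x y.
Proof. by rewrite fc_le0. Qed.
Lemma fc_le0_total x : fc_le 0 x || fc_le x 0.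
Proof.
rewrite fc_le0 fc_le0r; have /asboolP[H|H] := fc_valP x; apply/orP; [left|right]; apply/fc_ge0P => //.
Qed.
Lemma fc_normN x : fc_norm (- x) = fc_norm x.
Proof.
rewrite /fc_norm opprK; have := fc_le0_total x; rewrite fc_le0 fc_le0r.
case: ifP => H1; case: ifP => // H2 _.
have -> : x = 0 by apply: fc_le0_anti; rewrite ?fc_le0 ?fc_le0r ?H1 ?H2.
by rewrite oppr0.
Qed.
Lemma fc_ge0_norm x : fc_le 0 x -> fc_norm x = x.
Proof. by rewrite fc_le0 /fc_norm => ->. Qed.

HB.instance Definition _ := Num.IntegralDomain_isLeReal.Build fc_type
  fc_le0_add fc_le0_mul fc_le0_anti fc_sub_ge0 fc_le0_total fc_normN fc_ge0_norm (fun _ _ => erefl).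

Lemma fc_le0E x : (0 <= x) = fc_ge0 x.
Proof. exact: fc_le0. Qed.

End FieldConeType.

(** Q orders the fraction field of its residue ring, seen inside L. Numerators and denominators may
    both be taken in Q because a / s = a s / s^2. *)
Lemma frac_cone (A : comNzRingType) (Q : set A) (L : fieldType) (psi : {rmorphism A -> L}) :
  prime_cone Q -> (forall a, psi a = 0 <-> Q a /\ Q (- a)) ->
  exists C : field_cone L, forall a, Q a -> C (psi a).
Proof.
move=> [[QD QM Qsqr QN1] Qtot Qsupp] ker.
pose C0 (x : L) := exists a s, [/\ Q a, Q s, psi s != 0 & x = psi a / psi s].
have Q1 : Q 1 by rewrite -(mul1r 1); exact: Qsqr.
have Q0 : Q 0 by rewrite -(mul0r 0); exact: Qsqr.
have C0i a : Q a -> C0 (psi a).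
  by move=> Qa; exists a, 1; rewrite rmorph1 divr1 oner_eq0.
have C1 : C0 1 by rewrite -(rmorph1 psi); exact: C0i.
have CD x y : C0 x -> C0 y -> C0 (x + y).
  move=> [a [s [Qa Qs s0 ->]]] [b [t [Qb Qt t0 ->]]].
  exists (a * t + b * s), (s * t); split; rewrite ?rmorphD ?rmorphM.
  - by apply: (QD); apply: (QM).
  - exact: QM.
  - by rewrite mulf_neq0.
  - by field; rewrite s0 t0.
have CM x y : C0 x -> C0 y -> C0 (x * y).
  move=> [a [s [Qa Qs s0 ->]]] [b [t [Qb Qt t0 ->]]].
  exists (a * b), (s * t); split; rewrite ?rmorphM ?mulf_neq0 //; try exact: QM.
  by field; rewrite s0 t0.
have CV x : C0 x -> C0 x^-1.
  move=> [a [s [Qa Qs s0 ->]]]; have [->|a0] := eqVneq (psi a) 0.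
    by rewrite mul0r invr0 -(rmorph0 psi); exact: C0i.
  by exists s, a; split => //; rewrite invf_div.
have CB x y : C0 x -> C0 y -> C0 (x - y) \/ C0 (y - x).
  move=> [a [s [Qa Qs s0 ->]]] [b [t [Qb Qt t0 ->]]].
  have [H|H] := Qtot (a * t - b * s); [left|right].
    exists (a * t - b * s), (s * t); split; rewrite ?rmorphB ?rmorphM ?mulf_neq0 //; first exact: QM.
    by field; rewrite s0 t0.
  exists (- (a * t - b * s)), (s * t); split; rewrite ?rmorphN ?rmorphB ?rmorphM ?mulf_neq0 //; first exact: QM.
  by field; rewrite s0 t0.
have Canti x : C0 x -> C0 (- x) -> x = 0.
  move=> [a [s [Qa Qs s0 ->]]] [b [t [Qb Qt t0 /eqP]]].
  rewrite -subr_eq0 => /eqP E.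
  have : psi (a * t + b * s) = 0.
    rewrite rmorphD !rmorphM.
    have -> : psi a * psi t + psi b * psi s = - (- (psi a / psi s) - psi b / psi t) * (psi s * psi t).
      by field; rewrite s0 t0.
    by rewrite E oppr0 mul0r.
  move=> /ker[_ H].
  have : psi (a * t) = 0.
    apply/ker; split; first exact: QM.
    have -> : - (a * t) = - (a * t + b * s) + b * s by ring.
    by apply: (QD) => //; apply: (QM).
  by rewrite rmorphM => /eqP; rewrite mulf_eq0 (negPf t0) orbF => /eqP->; rewrite mul0r.
by exists (FieldCone C1 CD CM CV CB Canti).
Qed.

(** Non-negative elements of F need not be squares, so the weights are what makes this preorder
    contain the non-negative constants. *)
Inductive wsos (F : realFieldType) : {poly F} -> Prop :=
| wsos0 : wsos 0
| wsos_add (c : F) (s p : {poly F}) : 0 <= c -> wsos p -> wsos (c *: (s * s) + p).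

Section Wsos.
Variable F : realFieldType.
Implicit Types p q g : {poly F}.

Lemma wsosD p q : wsos p -> wsos q -> wsos (p + q).
Proof. by elim=> [|c s r c0 _ IH] Wq; rewrite ?add0r // -addrA; apply: wsos_add => //; exact: IH. Qed.

Lemma wsosM p q : wsos p -> wsos q -> wsos (p * q).
Proof.
elim=> [|c s r c0 _ IH] Wq; first by rewrite mul0r; exact: wsos0.
rewrite mulrDl; apply: wsosD; last exact: IH.
elim: Wq => [|d t q' d0 _ IH']; first by rewrite mulr0; exact: wsos0.
rewrite mulrDr; apply: wsosD => //.
have -> : c *: (s * s) * (d *: (t * t)) = (c * d) *: ((s * t) * (s * t)) + 0.
  by rewrite -scalerAl -scalerAr scalerA addr0; congr (_ *: _); ring.
by apply: wsos_add; [exact: mulr_ge0|exact: wsos0].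
Qed.

Lemma wsos_ge0 p x : wsos p -> 0 <= p.[x].
Proof.
elim=> [|c s q c0 _ IH]; first by rewrite horner0.
by rewrite hornerD hornerZ hornerM addr_ge0 // mulr_ge0 // -expr2 sqr_ge0.
Qed.

(** Each s is replaced by its remainder modulo g, with the same weight; squares of remainders have
    degree at most 2 deg g - 2. *)
Lemma wsos_mod g p : wsos p -> g != 0 ->
  exists q h, [/\ wsos q, p = q + g * h & (size q <= ((size g).-1).*2.-1)%N].
Proof.
move=> Wp g0; elim: Wp => [|c s r c0 _ [q [h [Wq -> sq]]]].
  by exists 0, 0; rewrite size_poly0 mulr0 addr0; split => //; exact: wsos0.
exists (c *: ((s %% g) * (s %% g)) + q), (h + c *: (s %/ g * (s %/ g) * g + (s %/ g) * (s %% g) *+ 2)).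
split; first exact: wsos_add.
  rewrite {1 2}(divp_eq s g); move: (s %/ g) (s %% g) => u v.
  by rewrite -!mul_polyC; ring.
rewrite (leq_trans (size_polyD _ _)) // geq_max sq andbT.
rewrite (leq_trans (size_scale_leq _ _)) //.
have : leq (size (s %% g)).+1 (size g) by rewrite ltn_modp.
move: (s %% g) => v lt; apply: leq_trans (size_polyMleq _ _) _.
by move: (size v) (size g) lt; lia.
Qed.

(* If -1 = sum c_i s_i^2 + g h with deg s_i < deg g, then h changes sign between a and b
   like g does, and has smaller degree. *)
Lemma adjoin_root_proper g a b p : g.[a] * g.[b] < 0 -> wsos p -> forall h, p + g * h <> -1.
Proof.
have [n] := ubnP (size g); elim: n => // n IHn in g p *.
rewrite ltnS => sg gab Wp h E.
have g0 : g != 0 by apply: contraTneq gab => ->; rewrite !horner0 mulr0 ltxx.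
have [q [h1 [Wq Ep sq]]] := wsos_mod Wp g0.
have {E}Eq : g * (h + h1) = - (1 + q) by move: E; rewrite Ep => E; rewrite -[1]opprK -E; ring.
have gh x : g.[x] * (h + h1).[x] < 0.
  by rewrite -hornerM Eq hornerN hornerD hornerC oppr_lt0 ltr_wpDr // wsos_ge0.
have hab : (h + h1).[a] * (h + h1).[b] < 0.
  have := gh b; rewrite -(nmulr_rgt0 _ (gh a)) mulrACA.
  by rewrite nmulr_rgt0.
have h0 : h + h1 != 0 by apply: contraTneq hab => ->; rewrite !horner0 mulr0 ltxx.
(* The same identity is now read with the cofactor in the role of g, and g as its cofactor. *)
apply: (IHn (h + h1) q _ hab Wq (g)); last first.
  by rewrite mulrC Eq; ring.
have := size_mul g0 h0; rewrite Eq size_polyN => S.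
have : leq (size (1 + q)) (maxn 1 (size q)) by rewrite (leq_trans (size_polyD _ _)) // size_poly1.
rewrite S => H.
have sg2 : (1 < size g)%N.
  rewrite ltnNge; apply/negP => /size1_polyC gC; move: gab; rewrite gC !hornerC.
  by rewrite ltNge -expr2 sqr_ge0.
move: H sq sg2 sg; move: (size _) (size _) (size _); lia.
Qed.

End Wsos.

Lemma fraction_split (R : idomainType) (x : {fraction R}) :
  exists a b : R, x = tofrac a / tofrac b.
Proof.
elim/quotW: x => r; exists (\n_r), (\d_r).
have d0 : tofrac (\d_r) != 0 by rewrite tofrac_eq0 denom_ratioP.
apply: (canRL (mulfK d0)); unlock FracField.tofrac.
apply: etrans (esym (FracField.pi_mul r (Ratio (\d_r) 1))) _.
apply/eqmodP; rewrite /= FracField.equivfE /FracField.mulf.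
by rewrite !numden_Ratio ?mulf_neq0 ?oner_eq0 ?denom_ratioP // !mulr1 mulrC.
Qed.

Section SupportQuotient.
Variables (A : comNzRingType) (P : set A).
Hypothesis coneP : prime_cone P.

Definition support : pred A := fun a => `[< P a /\ P (- a) >].

Lemma support_idealr_closed : idealr_closed support.
Proof.
have [[PD PM Psqr PN1] Ptot _] := coneP.
have P0 : P 0 by rewrite -(mul0r 0); exact: Psqr.
split.
- by apply/asboolP; rewrite oppr0.
- by apply/asboolP => -[].
- move=> a u v /asboolP[Pu PNu] /asboolP[Pv PNv]; apply/asboolP.
  rewrite opprD; have [Pa|PNa] := Ptot a.
    by split; apply: PD => //; rewrite -?mulrN; exact: PM.
  by split; apply: PD => //; [rewrite -mulrNN|rewrite -mulNr]; exact: PM.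
Qed.

Lemma support_prime : prime_idealr_closed support.
Proof.
have [_ _ Psupp] := coneP.
move=> u v /asboolP[/Psupp H /H{}H]; apply/orP.
by case: H => H; [left|right]; apply/asboolP.
Qed.

HB.instance Definition _ := isIdealr.Build A support support_idealr_closed.
HB.instance Definition _ := isPrimeIdealrClosed.Build A support support_prime.

Definition supp_quot := {ideal_quot (support : prime_idealr A)}.
HB.instance Definition _ := GRing.ComNzRing.on supp_quot.

(** Units and inverses are chosen classically, to give the quotient the integral domain structure
    over which fractions are formed. *)
Definition sq_unit : pred supp_quot := fun x => `[< exists y, y * x = 1 >].
Definition sq_inv (x : supp_quot) : supp_quot :=
  match pselect (exists y, y * x = 1) with
  | left ex => projT1 (cid ex) | right _ => x end.

Lemma sq_mulVx : {in sq_unit, left_inverse 1 sq_inv *%R}.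
Proof.
move=> x /asboolP ux; rewrite /sq_inv; case: pselect => // ex.
by case: (cid ex).
Qed.

Lemma sq_unitPl x y : y * x = 1 -> sq_unit x.
Proof. by move=> yx; apply/asboolP; exists y. Qed.

Lemma sq_invr_out : {in [predC sq_unit], sq_inv =1 id}.
Proof. by move=> x /asboolP ux; rewrite /sq_inv; case: pselect. Qed.

HB.instance Definition _ := GRing.ComNzRing_hasMulInverse.Build supp_quot
  sq_mulVx sq_unitPl sq_invr_out.
Lemma sq_domain : GRing.integral_domain_axiom supp_quot.
Proof. exact: Quotient.rquot_IdomainAxiom. Qed.
HB.instance Definition _ := GRing.ComUnitRing_isIntegral.Build supp_quot sq_domain.

Lemma supp_frac : exists (F : fieldType) (psi : {rmorphism A -> F}),
  (forall a, psi a = 0 <-> P a /\ P (- a)) /\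
  (forall x, exists a b, x = psi a / psi b).
Proof.
pose pi_q (a : A) : supp_quot := (\pi_{ideal_quot (support : prime_idealr A)} a)%qT.
pose f (a : A) : {fraction supp_quot} := tofrac (pi_q a).
have fB : {morph f : a b / a - b}.
  by move=> a b; rewrite /f /pi_q (rmorphB (\pi_{ideal_quot (support : prime_idealr A)})%qT) rmorphB.
have f1 : f 1 = 1 by rewrite /f /pi_q rmorph1 rmorph1.
have fM : {morph f : a b / a * b} by move=> a b; rewrite /f /pi_q !rmorphM.
pose m1 := GRing.isZmodMorphism.Build A _ f fB.
pose m2 := GRing.isMonoidMorphism.Build A _ f (f1, fM).
pose psi : {rmorphism A -> {fraction supp_quot}} := HB.pack f m1 m2.
exists {fraction supp_quot}, psi; split.
  have fE a : (f a == 0) = support a.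
    rewrite /f tofrac_eq0 /pi_q.
    have := @Quotient.idealrBE A (support : prime_idealr A) a 0.
    by rewrite subr0 rmorph0 => <-.
  by move=> a; split=> [/eqP|/asboolP H]; [rewrite fE => /asboolP|apply/eqP; rewrite fE].
move=> x; have [a [b ->]] := fraction_split x.
have piS (u : supp_quot) : exists a : A, u = pi_q a.
  by exists (repr u); rewrite /pi_q reprK.
by have [a' ->] := piS a; have [b' ->] := piS b; exists a', b'.
Qed.
End SupportQuotient.

Definition surj_pickle (B : countType) (T : Type) (f : B -> T)
  (fs : forall x, exists b, x = f b) (x : T) : nat := pickle (projT1 (cid (fs x))).
Lemma surj_pickleK (B : countType) (T : Type) (f : B -> T) (fs : forall x, exists b, x = f b) :
  pcancel (surj_pickle fs) (fun n => omap f (unpickle n)).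
Proof. by move=> x; rewrite /surj_pickle pickleK /=; case: (cid _) => b /= <-. Qed.

(** L is the fixed ambient field in which orderings will be enlarged. Countability passes from A to
    the fraction field, whose algebraic closure is taken. *)
Lemma closed_field_of_cone (A : comNzRingType) (e : A -> nat) (P : set A) :
  injective e -> prime_cone P ->
  exists (L : closedFieldType) (psi : {rmorphism A -> L}),
  forall a, psi a = 0 <-> P a /\ P (- a).
Proof.
move=> inje /supp_frac[F [psi [kerpsi surj]]].
pose ei n := if pselect (exists a, e a = n) is left ex then Some (projT1 (cid ex)) else None.
have eK : pcancel e ei.
  move=> a; rewrite /ei; case: pselect => [ex|[]]; last by exists a.
  by case: (cid ex) => b /= /inje ->.
pose A' : countType := HB.pack (A : Type) (Choice_isCountable.Build A eK) (Choice.class A).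
have surj' x : exists ab : A' * A', x = psi ab.1 / psi ab.2.
  by have [a [b ->]] := surj x; exists (a, b).
pose m := Choice_isCountable.Build F (surj_pickleK surj').
pose F' : countFieldType := HB.pack (F : Type) m (GRing.Field.class F).
have [L [FtoL _]] := countable_algebraic_closure F'.
exists L, (FtoL \o (psi : {rmorphism A -> F'})) => a.
rewrite -kerpsi /=; split=> [/eqP|->]; last by rewrite rmorph0.
by rewrite fmorph_eq0 => /eqP.
Qed.

(** In K[X] the preorder generated by the non-negative constants and by g and -g is proper, because
    g changes sign. It extends to a prime cone, whose support contains g; the generator of the
    support has a root xi in L, and evaluation at xi carries the cone to an ordering of K(xi). *)
Lemma adjoin_root (L : closedFieldType) (C : field_cone L) (g : {poly fc_type C}) a b :
  g.[a] * g.[b] < 0 ->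
  exists (C' : field_cone L) (xi : L), [/\ (C : set L) `<=` C',
    root (map_poly val g) xi & C' xi \/ C' (- xi)].
Proof.
move=> gab; set K := fc_type C in g a b gab *.
pose T (p : {poly K}) := exists s h, wsos s /\ p = s + g * h.
have wsq (p : {poly K}) : wsos (p * p).
  by rewrite -[p * p]addr0 -[p * p]scale1r; apply: wsos_add; [exact: ler01|exact: wsos0].
have wT (p : {poly K}) : wsos p -> T p by move=> Wp; exists p, 0; rewrite mulr0 addr0.
have [Q [TQ coneQ]] : exists P, T `<=` P /\ prime_cone P.
  apply: precone_extend; split.
  - move=> p q [s [h [Ws ->]]] [s' [h' [Ws' ->]]].
    by exists (s + s'), (h + h'); split; [exact: wsosD|ring].
  - move=> p q [s [h [Ws ->]]] [s' [h' [Ws' ->]]].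
    by exists (s * s'), (h * s' + s * h' + g * h * h'); split; [exact: wsosM|ring].
  - by move=> p; exact: wT.
  - by move=> [s [h [Ws E]]]; exact: (adjoin_root_proper gab Ws (esym E)).
have [S0 S1 SD] := support_idealr_closed coneQ.
have Sprime := support_prime coneQ; set S := support Q in S0 S1 SD Sprime.
have SM p q : q \in S -> p * q \in S by move=> Sq; rewrite -[p * q]addr0 SD.
have Sg : g \in S.
  apply/asboolP; split; apply: TQ; [exists 0, 1|exists 0, (-1)]; split; try exact: wsos0; ring.
have g0 : g != 0 by apply: contraTneq gab => ->; rewrite !horner0 mulr0 ltxx.
(* An element of least degree generates the support. *)
have [g1 [Sg1 g10 ming1]] : exists g1, [/\ g1 \in S, g1 != 0 &
    forall q, q \in S -> q != 0 -> leq (size g1) (size q)].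
  pose p n := `[< exists q : {poly K}, [/\ q \in S, q != 0 & size q = n] >].
  have exp : exists n, p n by exists (size g); apply/asboolP; exists g.
  case: (ex_minnP exp) => n /asboolP[q [Sq q0 <-]] min.
  by exists q; split => // r Sr r0; apply: min; apply/asboolP; exists r.
have dvdS q : q \in S -> g1 %| q.
  move=> Sq; apply: contraT => Nd.
  have : leq (size g1) (size (q %% g1)).
    apply: ming1; last by [].
    have -> : q %% g1 = (- (q %/ g1)) * g1 + q by rewrite {3}(divp_eq q g1); ring.
    by apply: SD.
  by rewrite leqNgt ltn_modp g10.
have constS c : c%:P \in S -> c = 0.
  move=> Sc; apply: contraNeq S1 => c0.
  have -> : (1 : {poly K}) = (c^-1)%:P * c%:P by rewrite -polyCM mulVf.
  exact: SM.
have szg1 : size (map_poly (val : K -> L) g1) != 1%N.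
  rewrite size_map_poly; apply: contraNneq g10 => s1.
  have /size1_polyC E : leq (size g1) 1 by rewrite s1.
  by move: Sg1; rewrite E => /constS ->.
have [xi rxi] := closed_rootP _ szg1.
pose ev : {rmorphism {poly K} -> L} := horner_eval xi \o map_poly (val : K -> L).
have evE p : ev p = (map_poly (val : K -> L) p).[xi] by [].
have evS q : q \in S -> ev q = 0.
  move=> /dvdS /dvdpP[h ->]; rewrite rmorphM [ev g1]evE.
  by move/rootP: rxi => ->; rewrite mulr0.
have kerev q : ev q = 0 <-> Q q /\ Q (- q).
  split=> [ev0|Sq]; last by apply: evS; apply/asboolP.
  apply/asboolP; apply: contraT => NSq.
  (* The support is prime, so it contains h or d. If d, then also its multiple q; if h, then d is
     constant by minimality of g1, and q and g1 cannot share the root xi. *)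
  pose d := gcdp q g1; pose h := g1 %/ d.
  have Eg1 : g1 = h * d by rewrite divpK // dvdp_gcdr.
  have : (h \in S) || (d \in S) by apply: Sprime; rewrite -Eg1.
  case/orP => [Sh|Sd]; last first.
    by case/negP: NSq; rewrite -[q](@divpK _ d) ?dvdp_gcdl //; exact: SM.
  have h0 : h != 0 by apply: contraNneq g10 => h0; rewrite Eg1 h0 mul0r.
  have d0 : d != 0 by apply: contraNneq g10 => d0; rewrite Eg1 d0 mulr0.
  have sd : size d == 1%N.
    have := ming1 _ Sh h0; rewrite {1}Eg1 size_mul //.
    by move: h0 d0; rewrite -!size_poly_gt0; move: (size h) (size d); lia.
  have /Bezout_eq1_coprimepP[[u v] /= uv] : coprimep q g1 by [].
  have := rmorph1 ev; rewrite -uv rmorphD !rmorphM ev0 (evS _ Sg1) !mulr0 addr0.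
  by move/esym/eqP; rewrite oner_eq0.
have [C' C'ev] := frac_cone coneQ kerev.
exists C', xi; split.
- move=> x Cx; have Px : x \in fc_pred C by apply/asboolP; left.
  have -> : x = ev (FcType Px)%:P by rewrite evE map_polyC hornerC.
  apply: C'ev; apply: TQ; apply: wT.
  rewrite -[_%:P]addr0 -[_%:P]mulr1 -[1]mulr1 mul_polyC; apply: wsos_add; last exact: wsos0.
  by rewrite fc_le0E; apply/fc_ge0P.
- by apply/rootP; rewrite -evE; exact: evS.
- have -> : xi = ev 'X by rewrite evE map_polyX hornerX.
  rewrite -rmorphN; case: coneQ => _ tot _.
  by have [H|H] := tot 'X; [left|right]; exact: C'ev.
Qed.

(** The root supplied may lie outside [a, b]. Then its linear factor has constant sign on [a, b],
    and the quotient still changes sign there and has lower degree. *)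
Lemma real_closed_of_root (K : realFieldType) :
  (forall (g : {poly K}) a b, g.[a] * g.[b] < 0 -> exists x, root g x) ->
  Num.real_closed_axiom K.
Proof.
move=> H g a b leab /andP[ga gb].
have [/eqP ga0|Nga] := boolP (g.[a] == 0); first by exists a; [rewrite lexx|apply/rootP].
have [/eqP gb0|Ngb] := boolP (g.[b] == 0); first by exists b; [rewrite leab lexx|apply/rootP].
have {ga gb Nga Ngb} : g.[a] * g.[b] < 0 by rewrite nmulr_rlt0 lt_neqAle ?Nga // eq_sym Ngb.
have [n] := ubnP (size g); elim: n => // n IHn in g *; rewrite ltnS => sg gab.
have [r rg] := H _ _ _ gab.
have [/andP[ar rb]|] := boolP (a <= r <= b); first by exists r => //; rewrite ar.
move=> Nr; have /factor_theorem[q Eg] := rg.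
have g0 : g != 0 by apply: contraTneq gab => ->; rewrite !horner0 mulr0 ltxx.
have q0 : q != 0 by apply: contraNneq g0 => q0; rewrite Eg q0 mul0r.
have sq : leq (size q).+1 n.
  by apply: leq_trans sg; rewrite Eg size_mul ?polyXsubC_eq0 // size_XsubC addn2.
have qab : q.[a] * q.[b] < 0.
  move: gab; rewrite Eg !hornerM mulrACA pmulr_llt0 //.
  rewrite !hornerXsubC; move: Nr; rewrite negb_and -!ltNge => /orP[ra|br].
    by rewrite mulr_gt0 // subr_gt0 // (lt_le_trans ra).
  by rewrite nmulr_rgt0 subr_lt0 // (le_lt_trans leab).
have [x xab rx] := IHn _ sq qab; exists x => //.
by rewrite Eg rootM rx.
Qed.

(** Among the field cones of L above the image of a prime cone, a maximal one is real closed: the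
    root that [adjoin_root] supplies lies in a larger field cone, hence already in the maximal
    one. *)
Theorem real_closed_extension (A : comNzRingType) (e : A -> nat) (T : set A) :
  injective e -> precone T ->
  exists (K : rcfType) (phi : {rmorphism A -> K}), forall a, T a -> 0 <= phi a.
Proof.
move=> inje /precone_extend[P [TP coneP]].
have [L [psi kerpsi]] := closed_field_of_cone inje coneP.
have [C0 C0psi] := frac_cone coneP kerpsi.
pose good (X : set L) := exists C : field_cone L, (C : set L) = X.
have [F goodF [X0 FX0] totF|M [C0M [C CM] maxM]] := @Zorn_above _ good C0 (ex_intro _ C0 erefl).
- pose U := \bigcup_(X in F) X.
  have mem2 a b : U a -> U b -> exists C : field_cone L, [/\ (C : set L) `<=` U, C a & C b].
    move=> Ua Ub; have [X [FX Xa Xb]] := chain_mem2 totF Ua Ub.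
    by have [C CX] := goodF _ FX; exists C; rewrite -CX in FX Xa Xb *; split => // x Cx; exists (C : set L).
  have U1 : U 1.
    by exists X0 => //; have [C <-] := goodF _ FX0; exact: fc1.
  have UD x y : U x -> U y -> U (x + y).
    by move=> Ux Uy; have [C [CU Cx Cy]] := mem2 _ _ Ux Uy; apply: CU; exact: fcD.
  have UM x y : U x -> U y -> U (x * y).
    by move=> Ux Uy; have [C [CU Cx Cy]] := mem2 _ _ Ux Uy; apply: CU; exact: fcM.
  have UV x : U x -> U x^-1.
    by move=> Ux; have [C [CU Cx _]] := mem2 _ _ Ux Ux; apply: CU; exact: fcV.
  have UB x y : U x -> U y -> U (x - y) \/ U (y - x).
    move=> Ux Uy; have [C [CU Cx Cy]] := mem2 _ _ Ux Uy.
    by have [H|H] := fcB Cx Cy; [left|right]; exact: CU.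
  have Uanti x : U x -> U (- x) -> x = 0.
    by move=> Ux Uy; have [C [CU Cx Cy]] := mem2 _ _ Ux Uy; exact: (fc_anti Cx Cy).
  by exists (FieldCone U1 UD UM UV UB Uanti).
have rcK : Num.real_closed_axiom (fc_type C).
  apply: real_closed_of_root => g a b /adjoin_root[C' [xi [CC' rxi C'xi]]].
  have C'C : (C' : set L) `<=` C by rewrite CM; apply: maxM; [rewrite -CM|exists C'].
  have Pxi : xi \in fc_pred C by apply/asboolP; case: C'xi => /C'C; [left|right].
  exists (FcType Pxi); apply/rootP; apply: val_inj; rewrite rmorph0.
  by move/rootP: rxi => <-; exact: (esym (horner_map val g (FcType Pxi))).
pose m := Num.RealField_isClosed.Build (fc_type C) rcK.
pose K : rcfType := HB.pack (fc_type C : Type) (Num.RealField.class (fc_type C)) m.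
have Cpsi a : P a -> C (psi a) by move=> Pa; rewrite [_ (psi a)](_ : _ = M (psi a)) ?CM //; apply: C0M; exact: C0psi.
have Ppsi a : psi a \in fc_pred C.
  apply/asboolP; case: coneP => _ tot _; rewrite -rmorphN.
  by have [H|H] := tot a; [left|right]; exact: Cpsi.
pose f (a : A) : K := FcType (Ppsi a).
have fB : {morph f : a b / a - b} by move=> a b; apply: val_inj; rewrite /= rmorphB.
have f1 : f 1 = 1 by apply: val_inj; rewrite /= rmorph1.
have fM : {morph f : a b / a * b} by move=> a b; apply: val_inj; rewrite /= rmorphM.
pose m1 := GRing.isZmodMorphism.Build A _ f fB.
pose m2 := GRing.isMonoidMorphism.Build A _ f (f1, fM).
pose phi : {rmorphism A -> K} := HB.pack f m1 m2.
exists K, phi => a Ta; have -> : (0 <= phi a) = fc_ge0 (f a) by exact: fc_le0E.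
by apply/fc_ge0P; apply: Cpsi; exact: TP.
Qed.

(** * Sign determination *)

Section Between.
Variable F : realFieldType.

Lemma above_below (x : F) (u : seq F) : (forall y, y \in u -> x < y) ->
  exists2 t, x < t & forall y, y \in u -> t < y.
Proof.
elim: u => [|z u IH] H; first by exists (x + 1) => //; lra.
have [|t xt tu] := IH; first by move=> y yu; apply: H; rewrite inE yu orbT.
have xz : x < z by apply: H; rewrite inE eqxx.
have [tz|zt] := ltP t z.
  by exists t => // y; rewrite inE => /orP[/eqP->|/tu].
exists ((x + z) / 2); first by lra.
move=> y; rewrite inE => /orP[/eqP->|/tu ty]; lra.
Qed.

Lemma between (l u : seq F) : (forall x y, x \in l -> y \in u -> x < y) ->
  exists t, (forall x, x \in l -> x < t) /\ (forall y, y \in u -> t < y).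
Proof.
elim: l => [|x l IH] H.
  elim: u {H} => [|z u [t [_ tu]]]; first by exists 0.
  have [tz|zt] := ltP t z.
    by exists t; split => // y; rewrite inE => /orP[/eqP->|/tu].
  exists (z - 1); split => // y; rewrite inE => /orP[/eqP->|/tu ty]; lra.
have [|t [lt tu]] := IH.
  by move=> x' y x'l yu; apply: H => //; rewrite inE x'l orbT.
have [xt|tx] := ltP x t.
  by exists t; split => // y; rewrite inE => /orP[/eqP->|/lt].
have [|s xs su] := @above_below x u; first by move=> y; apply: H; rewrite inE eqxx.
exists s; split => // y; rewrite inE => /orP[/eqP->//|/lt yt]; lra.
Qed.

Lemma nonroot_between (p : {poly F}) a b : p != 0 -> a < b ->
  exists2 c, a < c < b & p.[c] != 0.
Proof.
move=> p0 ab; apply: contrapT => H.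
(* More distinct points than p can have roots; the shift by 2 keeps all of them strictly inside. *)
pose pt (k : nat) := a + (b - a) / (k.+2)%:R.
have ba : 0 < b - a by rewrite subr_gt0.
have ptin k : a < pt k < b.
  rewrite /pt ltrDl divr_gt0 ?ltr0n //= -ltrBrDl ltr_pdivrMr ?ltr0n //.
  by rewrite ltr_pMr // ltr1n.
have rt k : root p (pt k).
  by apply: contrapT => /negP Nr; apply: H; exists (pt k).
have := @max_poly_roots _ p [seq pt k | k <- iota 0 (size p)] p0.
rewrite size_map size_iota ltnn => R; suff : false by []; apply: R.
  by apply/allP => _ /mapP[k _ ->].
rewrite map_inj_uniq ?iota_uniq // => i j /addrI /(mulfI (lt0r_neq0 ba)) /invr_inj /eqP.
by rewrite eqr_nat => /eqP[].
Qed.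

End Between.

(* t1 and t2 occupy the same position relative to the points paired by [rs]. *)
Definition corr (F1 F2 : realFieldType) (rs : seq (F1 * F2)) (t1 : F1) (t2 : F2) :=
  all (fun r => ((t1 < r.1) == (t2 < r.2)) && ((r.1 < t1) == (r.2 < t2))) rs.

Definition pswap (T1 T2 : Type) (r : T1 * T2) := (r.2, r.1).

Section Corr.
Variables F1 F2 : realFieldType.
Implicit Types (rs : seq (F1 * F2)).

Lemma corrP rs t1 t2 : corr rs t1 t2 <->
  (forall r, r \in rs -> (t1 < r.1) = (t2 < r.2) /\ (r.1 < t1) = (r.2 < t2)).
Proof.
split=> [/allP H r /H/andP[/eqP-> /eqP->]//|H].
by apply/allP => r /H[-> ->]; rewrite !eqxx.
Qed.

Lemma corr_eq rs t1 t2 r : corr rs t1 t2 -> r \in rs -> (t1 = r.1 <-> t2 = r.2).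
Proof.
move=> /corrP H /H[H1 H2]; split=> E; apply/eqP; rewrite eq_le !leNgt.
  by rewrite -H1 -H2 E ltxx.
by rewrite H1 H2 E ltxx.
Qed.

Lemma corr_sub rs rs' t1 t2 : {subset rs' <= rs} -> corr rs t1 t2 -> corr rs' t1 t2.
Proof. by move=> sub /corrP H; apply/corrP => r /sub/H. Qed.

Lemma corr_swap rs t1 t2 : corr (map (@pswap _ _) rs) t2 t1 = corr rs t1 t2.
Proof.
rewrite /corr all_map; apply: eq_all => r /=.
by rewrite (eq_sym (t1 < _)) (eq_sym (_ < t1)).
Qed.

Lemma corr_mid rs t1 t2 s1 s2 : corr rs t1 t2 -> corr rs s1 t2 -> corr rs t1 s2 -> corr rs s1 s2.
Proof.
move=> /corrP H /corrP H1 /corrP H2; apply/corrP => r rin.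
by have [<- <-] := H2 r rin; have [-> ->] := H r rin; have [-> ->] := H1 r rin.
Qed.

(** That is, [rs] is the graph of an order isomorphism between finite subsets of F1 and F2. *)
Definition compat rs := forall r, r \in rs -> corr rs r.1 r.2.

Lemma compat_sub rs rs' : {subset rs' <= rs} -> compat rs -> compat rs'.
Proof. by move=> sub H r /sub/H; apply: corr_sub. Qed.

Lemma corr_exists rs t1 : compat rs -> exists t2, corr rs t1 t2.
Proof.
move=> comp; have [/hasP[r rin /eqP->]|Nt] := boolP (has (fun r => t1 == r.1) rs).
  by exists r.2; exact: comp.
have [|t2 [lt2 t2u]] := @between _ [seq r.2 | r <- rs & r.1 < t1] [seq r.2 | r <- rs & t1 < r.1].
  move=> _ _ /mapP[r + ->] /mapP[r' + ->]; rewrite !mem_filter => /andP[rt rin] /andP[tr' r'in].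
  by have /corrP/(_ _ r'in)[<- _] := comp _ rin; exact: lt_trans tr'.
exists t2; apply/corrP => r rin.
have [lt|gt|eq] := ltgtP t1 r.1.
- have lt2r : t2 < r.2 by apply: t2u; apply/mapP; exists r; rewrite // mem_filter lt.
  by rewrite lt2r; split => //; rewrite lt_gtF.
- have lt2r : r.2 < t2 by apply: lt2; apply/mapP; exists r; rewrite // mem_filter gt.
  by rewrite lt2r; split => //; rewrite lt_gtF.
- by case/hasP: Nt; exists r; rewrite // eq.
Qed.

Lemma next_point rs t1 : (exists2 r, r \in rs & t1 < r.1) ->
  exists r, [/\ r \in rs, t1 < r.1 & forall r', r' \in rs -> t1 < r'.1 -> r.1 <= r'.1].
Proof.
elim: rs => [|r0 rs IH] [r]; first by rewrite in_nil.
move=> rin tr.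
have [/hasP/= H|/hasPn Nh] := boolP (has (fun r => t1 < r.1) rs).
  have [m [min tm mmin]] := IH H.
  have [/andP[tr0 r0m]|Nr0] := boolP ((t1 < r0.1) && (r0.1 <= m.1)).
    exists r0; split; rewrite ?inE ?eqxx // => r'; rewrite inE => /orP[/eqP->//|r'in tr'].
    exact: le_trans r0m (mmin _ r'in tr').
  exists m; split; rewrite ?inE ?min ?orbT // => r'; rewrite inE => /orP[/eqP-> tr0|]; last exact: mmin.
  by move: Nr0; rewrite tr0 /= -ltNge => /ltW.
move: rin; rewrite inE => /orP[/eqP E|/Nh]; last by rewrite tr.
exists r0; split; rewrite ?inE ?eqxx -?E // => r'; rewrite inE => /orP[/eqP->//|/Nh/negPf->//].
Qed.

End Corr.

Section PolyEnds.
Variable F : rcfType.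

Lemma sgz_pinfty (p : {poly F}) : exists b, forall y, b <= y -> sgz p.[y] = sgz (lead_coef p).
Proof.
have [->|p0] := eqVneq p 0; first by exists 0 => y _; rewrite horner0 lead_coef0.
exists (cauchy_bound p) => y by_; rewrite -(sgz_sgr p.[y]) (sgp_pinftyP (ge_cauchy_bound p0)) ?sgz_sgr //.
by rewrite in_itv /= by_.
Qed.

Lemma all_roots (p : {poly F}) : p != 0 -> exists s : seq F, forall x, (x \in s) = root p x.
Proof.
move=> p0; exists (roots p (- cauchy_bound p) (cauchy_bound p)) => x; apply/idP/idP.
  exact: root_roots.
by move=> rx; rewrite -root_is_roots //; exact: root_in_cauchy_bound.
Qed.

Lemma deriv_eq0 (p : {poly F}) : p^`() = 0 -> p = (p`_0)%:P.
Proof.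
move=> dp; apply/polyP => -[|i]; rewrite coefC //=.
have := congr1 (fun q : {poly F} => q`_i) dp; rewrite coef_deriv coef0 => /eqP.
by rewrite mulrn_eq0 /= => /eqP.
Qed.

End PolyEnds.

Section Table.
Variables F1 F2 : rcfType.
Implicit Types (rs : seq (F1 * F2)) (pp : {poly F1} * {poly F2}).

Definition samesign (t : F1 * F2) := sgz t.1 = sgz t.2.
(** Matching signs of coefficients force equal degrees and equal signs at infinity, which settles
    the unbounded gaps. *)
Definition samecoef pp := forall i, samesign (pp.1`_i, pp.2`_i).
Definition ev pp t := (pp.1.[t.1], pp.2.[t.2]).

Lemma samesign_gt0 t : samesign t -> (0 < t.1) = (0 < t.2).
Proof. by rewrite -sgz_gt0 => ->; rewrite sgz_gt0. Qed.
Lemma samesign_lt0 t : samesign t -> (t.1 < 0) = (t.2 < 0).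
Proof. by rewrite -sgz_lt0 => ->; rewrite sgz_lt0. Qed.
Lemma samesign_eq0 t : samesign t -> (t.1 == 0) = (t.2 == 0).
Proof. by rewrite -sgz_eq0 => ->; rewrite sgz_eq0. Qed.

Lemma samecoef_size pp : samecoef pp -> size pp.1 = size pp.2.
Proof.
move=> H; apply/eqP; rewrite eqn_leq; apply/andP; split; apply/leq_sizeP => j sj; apply/eqP.
  by rewrite (samesign_eq0 (H j)) /= nth_default.
by rewrite -(samesign_eq0 (H j)) /= nth_default.
Qed.

Lemma samecoef_lead pp : samecoef pp -> samesign (lead_coef pp.1, lead_coef pp.2).
Proof. by move=> H; rewrite !lead_coefE (samecoef_size H). Qed.

Lemma samecoef_eq0 pp : samecoef pp -> (pp.1 == 0) = (pp.2 == 0).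
Proof. by move=> H; rewrite -!size_poly_eq0 (samecoef_size H). Qed.

Definition offpoints rs (t1 : F1) := forall r, r \in rs -> t1 != r.1.

Lemma offP rs t1 t2 r : offpoints rs t1 -> corr rs t1 t2 -> r \in rs ->
  (t1 < r.1 /\ t2 < r.2) \/ (r.1 < t1 /\ r.2 < t2).
Proof.
move=> off /corrP c rin; have [<- <-] := c _ rin.
by have := off _ rin; rewrite neq_lt => /orP[->|->]; [left|right].
Qed.

(** The right end of the gap is the next point of [rs] or, in the last gap, a point beyond which
    each polynomial has the sign of its leading coefficient. *)
Lemma right_end rs pp (t1 : F1) (t2 : F2) : compat rs -> samecoef pp ->
  (forall r, r \in rs -> samesign (ev pp r)) -> corr rs t1 t2 -> offpoints rs t1 ->
  exists s1 s2, [/\ t1 < s1, t2 < s2, samesign (ev pp (s1, s2)),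
    forall y, t1 <= y < s1 -> corr rs y t2 & forall y, t2 <= y < s2 -> corr rs t1 y].
Proof.
move=> comp same sgn c off.
have [/hasP up|/hasPn Nup] := boolP (has (fun r => t1 < r.1) rs).
  have [m [min tm mmin]] := next_point up.
  have [_ tm2] : t1 < m.1 /\ t2 < m.2.
    by have [//|[mt _]] := offP off c min; have := lt_trans tm mt; rewrite ltxx.
  exists m.1, m.2; split => //; first exact: (sgn m).
    move=> y /andP[ty ym]; apply/corrP => r rin.
    have [[tr tr2]|[rt rt2]] := offP off c rin.
      have yr := lt_le_trans ym (mmin _ rin tr).
      by rewrite yr tr2 (lt_gtF yr) (lt_gtF tr2).
    have ry := lt_le_trans rt ty.
    by rewrite ry rt2 (lt_gtF ry) (lt_gtF rt2).
  move=> y /andP[ty ym]; apply/corrP => r rin.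
  have [[tr tr2]|[rt rt2]] := offP off c rin.
    have mr : m.2 <= r.2.
      by have /corrP/(_ _ min)[E _] := comp _ rin; rewrite leNgt -E ltNge negbK mmin.
    have yr := lt_le_trans ym mr.
    by rewrite yr tr (lt_gtF yr) (lt_gtF tr).
  have ry := lt_le_trans rt2 ty.
  by rewrite ry rt (lt_gtF ry) (lt_gtF rt).
have [b1 H1] := sgz_pinfty pp.1; have [b2 H2] := sgz_pinfty pp.2.
have low r : r \in rs -> r.1 < t1 /\ r.2 < t2.
  by move=> rin; have [[tr _]|//] := offP off c rin; move: (Nup _ rin); rewrite tr.
exists (Num.max b1 (t1 + 1)), (Num.max b2 (t2 + 1)); split.
- by rewrite lt_max ltrDl ltr01 orbT.
- by rewrite lt_max ltrDl ltr01 orbT.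
- by rewrite /samesign /= H1 ?le_max ?lexx // H2 ?le_max ?lexx //; exact: samecoef_lead.
- move=> y /andP[ty _]; apply/corrP => r /low[rt rt2]; have ry := lt_le_trans rt ty.
  by rewrite ry rt2 (lt_gtF ry) (lt_gtF rt2).
- move=> y /andP[ty _]; apply/corrP => r /low[rt rt2]; have ry := lt_le_trans rt2 ty.
  by rewrite ry rt (lt_gtF ry) (lt_gtF rt).
Qed.
End Table.

Section Mirror.
Variables F1 F2 : rcfType.
Implicit Types (rs : seq (F1 * F2)) (pp : {poly F1} * {poly F2}).

Definition neg (t : F1 * F2) : F1 * F2 := (- t.1, - t.2).
Definition neg_polys pp := (pp.1 \Po - 'X, pp.2 \Po - 'X).

Lemma corr_neg rs (t1 : F1) (t2 : F2) : corr (map neg rs) (- t1) (- t2) = corr rs t1 t2.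
Proof. by rewrite /corr all_map; apply: eq_all => r /=; rewrite !ltrN2 andbC. Qed.

Lemma ev_neg pp (t : F1 * F2) : ev (neg_polys pp) (neg t) = ev pp t.
Proof. by rewrite /ev /= !horner_comp !hornerE !opprK. Qed.

Lemma coef_comp_polyNX (F : comNzRingType) (p : {poly F}) i : (p \Po - 'X)`_i = (-1) ^+ i * p`_i.
Proof.
rewrite comp_polyE coef_sum.
have E k : (p`_k *: (- 'X) ^+ k)`_i = (-1) ^+ k * p`_k * (i == k)%:R.
  have -> : (- 'X) ^+ k = ((-1) ^+ k)%:P * 'X^k :> {poly F}.
    by rewrite polyC_exp polyCN -exprMn mulN1r.
  by rewrite coefZ coefCM coefXn; ring.
under eq_bigr do rewrite E.
have [lt|ge] := ltnP i (size p).
  rewrite (bigD1 (Ordinal lt)) //= eqxx mulr1 big1 ?addr0 // => k.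
  by rewrite -val_eqE eq_sym /= => /negPf->; rewrite mulr0.
rewrite nth_default // mulr0 big1 // => k _.
by rewrite gtn_eqF ?mulr0 // (leq_trans (ltn_ord k)).
Qed.

Lemma samecoef_neg pp : samecoef pp -> samecoef (neg_polys pp).
Proof.
move=> H i; rewrite /samesign /= !coef_comp_polyNX -signr_odd -[in RHS]signr_odd.
by have := H i; case: odd; rewrite ?expr1 ?expr0 ?mul1r // !mulN1r /samesign !sgzN => ->.
Qed.

(** The reflection x -> -x reverses both orders and so turns this into [right_end]. *)
Lemma left_end rs pp (t1 : F1) (t2 : F2) : compat rs -> samecoef pp ->
  (forall r, r \in rs -> samesign (ev pp r)) -> corr rs t1 t2 -> offpoints rs t1 ->
  exists s1 s2, [/\ s1 < t1, s2 < t2, samesign (ev pp (s1, s2)),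
    forall y, s1 < y <= t1 -> corr rs y t2 & forall y, s2 < y <= t2 -> corr rs t1 y].
Proof.
move=> comp same sgn c off.
have [||||s1 [s2 [H1 H2 H3 H4 H5]]] := @right_end _ _ (map neg rs) (neg_polys pp) (- t1) (- t2) _ (samecoef_neg same).
- by move=> _ /mapP[r rin ->]; rewrite corr_neg; exact: comp.
- by move=> _ /mapP[r rin ->]; rewrite ev_neg; exact: sgn.
- by rewrite corr_neg.
- by move=> _ /mapP[r rin ->]; rewrite eqr_opp; exact: off.
exists (- s1), (- s2); split.
- by rewrite ltrNl.
- by rewrite ltrNl.
- by rewrite -ev_neg /neg /= !opprK.
- by move=> y /andP[sy yt]; rewrite -corr_neg; apply: H4; rewrite lerN2 yt ltrNl.
- by move=> y /andP[sy yt]; rewrite -corr_neg; apply: H5; rewrite lerN2 yt ltrNl.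
Qed.

End Mirror.

Lemma samecoef_deriv (F1 F2 : rcfType) (pp : {poly F1} * {poly F2}) :
  samecoef pp -> samecoef (pp.1^`(), pp.2^`()).
Proof.
have E (F : rcfType) (x : F) k : sgz (x *+ k.+1) = sgz x.
  by rewrite -mulr_natr sgzM (@gtr0_sgz _ k.+1%:R) ?ltr0n // mulr1.
by move=> H i; rewrite /samesign /= !coef_deriv !E; exact: H.
Qed.

Section Swap.
Variables F1 F2 : rcfType.
Implicit Types (rs : seq (F1 * F2)) (pp : {poly F1} * {poly F2}).

(* The points of [rs] cut both lines into matching pieces on which the paired polynomials
   have the same signs; each point is a root of some nonzero member of [PP]. *)
Definition table (PP : seq ({poly F1} * {poly F2})) rs :=
  [/\ compat rs,
    forall t1 t2, corr rs t1 t2 -> forall pp, pp \in PP -> samesign (ev pp (t1, t2)) &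
    forall r, r \in rs -> exists2 pp, pp \in PP & pp.1 != 0 /\ root pp.1 r.1].

Lemma off_swap rs t1 t2 : corr rs t1 t2 -> offpoints rs t1 -> offpoints (map (@pswap _ _) rs) t2.
Proof.
move=> c off _ /mapP[r rin ->] /=; apply: contraNN (off _ rin) => /eqP E.
by apply/eqP; apply/(corr_eq c rin).
Qed.

Lemma compat_swap rs : compat rs -> compat (map (@pswap _ _) rs).
Proof. by move=> comp _ /mapP[r rin ->]; rewrite corr_swap; exact: comp. Qed.

Lemma samecoef_swap pp : samecoef pp -> samecoef (pswap pp).
Proof. by move=> H i; rewrite /samesign /= -H. Qed.

End Swap.

Section AddPoly.
Variables F1 F2 : rcfType.
Implicit Types (rs : seq (F1 * F2)) (pp : {poly F1} * {poly F2}).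

(* On a gap where both polynomials increase, opposite signs at t1 and t2 force a root on
   either side; pairing these two roots contradicts the order of t1 and t2. *)
Lemma crossed_roots rs pp (t1 : F1) (t2 : F2) : compat rs -> samecoef pp ->
  (forall r, r \in rs -> samesign (ev pp r)) ->
  (forall t1 t2, corr rs t1 t2 -> samesign (ev (pp.1^`(), pp.2^`()) (t1, t2))) ->
  corr rs t1 t2 -> offpoints rs t1 -> 0 < pp.1^`().[t1] ->
  0 <= pp.1.[t1] -> pp.2.[t2] <= 0 ->
  exists z1 z2, [/\ z1 <= t1, t2 <= z2, root pp.1 z1, root pp.2 z2 & corr rs z1 z2].
Proof.
case: pp => p1 p2 /= comp same sgn der c off dp p1t p2t.
have dp2 : 0 < p2^`().[t2] by have := samesign_gt0 (der _ _ c); rewrite /= dp.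
have der1 y : corr rs y t2 -> 0 < p1^`().[y] by move=> cy; have := samesign_gt0 (der _ _ cy); rewrite /= dp2.
have der2 y : corr rs t1 y -> 0 < p2^`().[y] by move=> cy; have := samesign_gt0 (der _ _ cy); rewrite /= dp.
have [s1 [s2 [ts1 ts2 sgs cs1 cs2]]] := right_end comp same sgn c off.
have [l1 [l2 [lt1 lt2 sgl cl1 cl2]]] := left_end comp same sgn c off.
have p1s : 0 < p1.[s1].
  apply: le_lt_trans p1t _; apply: (@ltr_hornerW _ _ t1 s1) => //; rewrite ?in_itv /= ?lexx ?(ltW ts1) //.
  by move=> x; rewrite in_itv /= => /andP[tx xs]; apply: der1; apply: cs1; rewrite (ltW tx).
have p2s : 0 < p2.[s2] by have := samesign_gt0 sgs; rewrite /= p1s.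
have p2l : p2.[l2] < 0.
  apply: lt_le_trans p2t; apply: (@ltr_hornerW _ _ l2 t2) => //; rewrite ?in_itv /= ?lexx ?(ltW lt2) //.
  by move=> x; rewrite in_itv /= => /andP[lx xt]; apply: der2; apply: cl2; rewrite lx ltW.
have p1l : p1.[l1] < 0 by have := samesign_lt0 sgl; rewrite /= p2l.
have [z1 /andP[lz1 z1t] rz1] : exists2 z1, l1 < z1 <= t1 & root p1 z1.
  have [|z zin rz] := @polyrcf.poly_ivt _ p1 _ _ (ltW lt1); first by rewrite nmulr_rle0.
  exists z => //; move: zin; rewrite in_itv /= => /andP[lz ->]; rewrite andbT lt_neqAle lz andbT.
  by apply: contraTneq p1l => ->; rewrite (rootP rz) ltxx.
have [z2 /andP[tz2 z2s] rz2] : exists2 z2, t2 <= z2 < s2 & root p2 z2.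
  have [|z zin rz] := @polyrcf.poly_ivt _ p2 _ _ (ltW ts2); first by rewrite pmulr_lle0.
  exists z => //; move: zin; rewrite in_itv /= => /andP[-> zs]; rewrite lt_neqAle zs andbT /=.
  by apply: contraTneq p2s => <-; rewrite (rootP rz) ltxx.
exists z1, z2; split => //; apply: (corr_mid c).
  by apply: cl1; rewrite lz1.
by apply: cs2; rewrite tz2.
Qed.

(** The sign is constant on the gap around t1, so a zero at t1 would make the polynomial vanish on
    an interval. *)
Lemma nonzero_off rs pp (t1 : F1) (t2 : F2) : compat rs -> samecoef pp ->
  (forall t1 t2, corr rs t1 t2 -> samesign (ev pp (t1, t2))) ->
  corr rs t1 t2 -> offpoints rs t1 -> pp.1 != 0 -> pp.1.[t1] != 0.
Proof.
move=> comp same sgn c off p0.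
have [s1 [s2 [ts1 _ _ cs1 _]]] := right_end comp same (fun r rin => sgn _ _ (comp r rin)) c off.
have [y /andP[ty ys] py] := nonroot_between p0 ts1.
have := samesign_eq0 (sgn _ _ (cs1 y _)); rewrite /= (ltW ty) ys => /(_ isT).
have := samesign_eq0 (sgn _ _ c); rewrite /= => -> <-; exact: py.
Qed.

End AddPoly.

Section RootOrder.
Variables F1 F2 : rcfType.
Implicit Types (rs : seq (F1 * F2)) (pp : {poly F1} * {poly F2}).

(** If the order were reversed on the F2 side, no point of [rs] could lie in [z1, y1]. Rolle's
    theorem would then give a zero of the derivative inside a gap, against [nonzero_off]. *)
Lemma root_order rs pp (z1 y1 : F1) (z2 y2 : F2) : compat rs -> samecoef pp ->
  (forall t1 t2, corr rs t1 t2 -> samesign (ev (pp.1^`(), pp.2^`()) (t1, t2))) ->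
  pp.1^`() != 0 ->
  corr rs z1 z2 -> corr rs y1 y2 -> root pp.1 z1 -> root pp.1 y1 ->
  z1 < y1 -> z2 < y2.
Proof.
case: pp => p1 p2 /= comp same der dp0 cz cy rz ry zy; rewrite ltNge; apply/negP => yz.
have gap r : r \in rs -> ~~ (z1 <= r.1 <= y1).
  move=> rin; apply/negP => /andP[zr ry1].
  have /corrP/(_ _ rin)[_ E1] := cz; have /corrP/(_ _ rin)[E2 _] := cy.
  have zr2 : z2 <= r.2 by rewrite leNgt -E1 -leNgt.
  have ry2 : r.2 <= y2 by rewrite leNgt -E2 -leNgt.
  have e1 : z2 = r.2 by apply/eqP; rewrite eq_le zr2 (le_trans ry2).
  have e2 : y2 = r.2 by apply/eqP; rewrite eq_le ry2 (le_trans yz) // e1.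
  by move: zy; rewrite ((corr_eq cz rin).2 e1) ((corr_eq cy rin).2 e2) ltxx.
have [w win dw] := poly_rolle zy (etrans (rootP rz) (esym (rootP ry))).
move: win; rewrite in_itv /= => /andP[zw wy].
have cw : corr rs w z2.
  apply/corrP => r rin; have /corrP/(_ _ rin)[<- <-] := cz.
  have := gap _ rin; rewrite negb_and -!ltNge => /orP[rz1|yr1].
    by rewrite rz1 (lt_trans rz1 zw) (lt_gtF rz1) (lt_gtF (lt_trans rz1 zw)).
  have zr := lt_trans zy yr1; have wr := lt_trans wy yr1.
  by rewrite zr wr (lt_gtF zr) (lt_gtF wr).
have off : offpoints rs w.
  by move=> r rin; apply: contraNneq (gap _ rin) => <-; rewrite !ltW.
have sameD := samecoef_deriv same.
by have := nonzero_off comp sameD der cw off dp0; rewrite /= dw eqxx.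
Qed.
End RootOrder.

Section AddTable.
Variables F1 F2 : rcfType.
Implicit Types (rs : seq (F1 * F2)) (pp : {poly F1} * {poly F2}) (PP : seq ({poly F1} * {poly F2})).

(** Unless it is constant, the new polynomial is strictly monotone on each gap, its derivative being
    in the table already. Hence a gap holds at most one root, and pairing the roots in corresponding
    positions extends the table. *)
Lemma table_add PP rs pp : table PP rs -> samecoef pp ->
  (pp.1^`(), pp.2^`()) \in PP ->
  (forall r, r \in rs -> samesign (ev pp r)) ->
  exists rs', table (pp :: PP) rs'.
Proof.
case: pp => p1 p2 [comp sgn rts] same dPP sgr; have der t1 t2 c := sgn t1 t2 c _ dPP.
have [dp0|dp0] := eqVneq p1^`() 0.
  have dp2 : p2^`() = 0 by apply/eqP; rewrite -(samecoef_eq0 (samecoef_deriv same)) dp0.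
  exists rs; split => //.
    move=> t1 t2 c pp; rewrite inE => /orP[/eqP->|]; last exact: sgn.
    by rewrite /samesign /= (deriv_eq0 dp0) (deriv_eq0 dp2) !hornerC; exact: same.
  by move=> r /rts[pp ppin H]; exists pp; rewrite // inE ppin orbT.
have p10 : p1 != 0 by apply: contraNneq dp0 => ->; rewrite derivC.
have p20 : p2 != 0 by rewrite -(samecoef_eq0 same).
have dp20 : p2^`() != 0 by rewrite -(samecoef_eq0 (samecoef_deriv same)).
have [s1 s1E] := all_roots p10; have [s2 s2E] := all_roots p20.
(* A root that is already a point of [rs] is paired here with its old partner only, by [corr_eq]. *)
pose rs' := rs ++ [seq z <- [seq (x, y) | x <- s1, y <- s2] | corr rs z.1 z.2].
have rsP z : z \in rs' -> z \in rs \/ [/\ corr rs z.1 z.2, root p1 z.1 & root p2 z.2].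
  rewrite mem_cat mem_filter => /orP[|/andP[c /allpairsP[[x y] [xin yin E]]]]; [by left|right].
  by move: c; rewrite E /= => c; rewrite -s1E -s2E.
have rsI z1 z2 : corr rs z1 z2 -> root p1 z1 -> root p2 z2 -> (z1, z2) \in rs'.
  move=> c r1 r2; rewrite mem_cat mem_filter /= c /=; apply/orP; right.
  by apply/allpairsP; exists (z1, z2); rewrite s1E s2E.
have subrs : {subset rs <= rs'} by move=> r; rewrite mem_cat => ->.
exists rs'; split.
- have compS := compat_swap comp; have sameS := samecoef_swap same.
  have derS t2 t1 : corr (map (@pswap _ _) rs) t2 t1 -> samesign (ev (p2^`(), p1^`()) (t2, t1)).
    by rewrite corr_swap => c; rewrite /samesign /=; apply/esym; exact: (der _ _ c).
  move=> z /rsP zin; apply/corrP => r /rsP rin.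
  case: zin rin => [zin|[cz rz1 rz2]] [rin|[cr rr1 rr2]].
  + by have /corrP/(_ _ rin) := comp _ zin.
  + by have /corrP/(_ _ zin)[-> ->] := cr.
  + by have /corrP/(_ _ rin) := cz.
  + have ord := root_order comp same der dp0.
    have ordS x y u v cx cy := @root_order _ _ _ _ x y u v compS sameS derS dp20 cx cy.
    split; apply/idP/idP; [exact: ord|apply: ordS; rewrite ?corr_swap //|exact: ord|apply: ordS; rewrite ?corr_swap //].
- move=> t1 t2 c pp; rewrite inE => /orP[/eqP->|]; last exact: (sgn _ _ (corr_sub subrs c)).
  have c0 := corr_sub subrs c.
  have [/hasP[r rin /eqP E]|Noff] := boolP (has (fun r => t1 == r.1) rs).
    by have := sgr _ rin; rewrite /samesign /= -E; have [H _] := corr_eq c0 rin; rewrite (H E).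
  have off : offpoints rs t1 by move=> r rin; apply: contraNneq Noff => E; apply/hasP; exists r; rewrite // E.
  (* Stated for any pair with the same roots as p1 and p2, so that it also serves -p1 and -p2 when
     the derivative is negative. *)
  have key q1 q2 : samecoef (q1, q2) -> (forall r, r \in rs -> samesign (ev (q1, q2) r)) ->
      (forall t1 t2, corr rs t1 t2 -> samesign (ev (q1^`(), q2^`()) (t1, t2))) ->
      (forall z, root q1 z = root p1 z) -> (forall z, root q2 z = root p2 z) ->
      0 < q1^`().[t1] -> samesign (ev (q1, q2) (t1, t2)).
    move=> sameq sgq derq rq1 rq2 dpos; apply: contrapT => /eqP/=.
    have both0 : root q1 t1 -> root q2 t2 -> sgz q1.[t1] != sgz q2.[t2] -> False.
      by move=> /rootP-> /rootP->; rewrite !sgz0 eqxx.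
    move=> Neq; have : (0 <= q1.[t1]) && (q2.[t2] <= 0) || (q1.[t1] <= 0) && (0 <= q2.[t2]).
      by move: Neq; do 2!case: sgzP.
    case/orP=> /andP[h1 h2].
      (* The matched roots satisfy z1 <= t1 and t2 <= z2, while t1 and t2 lie on the same side of
         them; so t1 = z1 and t2 = z2, and both values are 0. *)
      have [z1 [z2 [zt tz rz1 rz2 cz]]] := crossed_roots comp sameq sgq derq c0 off dpos h1 h2.
      have zin : (z1, z2) \in rs' by apply: rsI; rewrite -?rq1 -?rq2.
      have /corrP/(_ _ zin)[/= E1 E2] := c.
      have ez1 : t1 = z1 by apply/eqP; rewrite eq_le zt andbT leNgt E2 -leNgt.
      have ez2 : t2 = z2 by apply/eqP; rewrite eq_le tz /= leNgt -E1 -leNgt.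
      by apply: both0 Neq; rewrite ?ez1 ?ez2.
    have c0S : corr (map (@pswap _ _) rs) t2 t1 by rewrite corr_swap.
    have dpos2 : 0 < q2^`().[t2] by have := samesign_gt0 (derq _ _ c0); rewrite /= dpos.
    have [||z2 [z1 [zt tz rz2 rz1 cz]]] := @crossed_roots _ _ _ (q2, q1) t2 t1
      (compat_swap comp) (samecoef_swap sameq) _ _ c0S (off_swap c0 off) dpos2 h2 h1.
    + by move=> _ /mapP[r rin ->]; exact: (esym (sgq _ rin)).
    + by move=> u v; rewrite corr_swap => cuv; exact: (esym (derq _ _ cuv)).
    have zin : (z1, z2) \in rs' by apply: rsI; [rewrite -corr_swap|rewrite -rq1|rewrite -rq2].
    have /corrP/(_ _ zin)[/= E1 E2] := c.
    have ez1 : t1 = z1 by apply/eqP; rewrite eq_le tz /= leNgt E1 -leNgt.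
    have ez2 : t2 = z2 by apply/eqP; rewrite eq_le zt andbT leNgt -E2 -leNgt.
    by apply: both0 Neq; rewrite ?ez1 ?ez2.
  have := nonzero_off comp (samecoef_deriv same) der c0 off dp0; rewrite neq_lt => /orP[neg|pos]; last first.
    by apply: key.
  have : samesign (ev (- p1, - p2) (t1, t2)).
    apply: key.
    + by move=> i; rewrite /samesign /= !coefN !sgzN same.
    + by move=> r rin; rewrite /samesign /= !hornerN !sgzN (sgr _ rin).
    + by move=> u v cuv; rewrite /samesign /= !derivN !hornerN !sgzN (der _ _ cuv).
    + by move=> z; rewrite rootN.
    + by move=> z; rewrite rootN.
    + by rewrite derivN hornerN oppr_gt0.
  by rewrite /samesign /= !hornerN !sgzN => /oppr_inj.
- move=> z /rsP[/rts[pp ppin H]|[_ rz _]]; first by exists pp; rewrite // inE ppin orbT.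
  by exists (p1, p2); rewrite // inE eqxx.
Qed.

Lemma table_roots PP rs pp (y : F1) : table PP rs -> samecoef pp -> pp \in PP ->
  pp.1 != 0 -> root pp.1 y -> exists2 r, r \in rs & r.1 = y.
Proof.
move=> [comp sgn _] same ppin p0 ry; apply: contrapT => Nr.
have off : offpoints rs y by move=> r rin; apply/eqP => E; apply: Nr; exists r.
have [y2 cy] := corr_exists y comp.
by have := nonzero_off comp same (fun t1 t2 c => sgn t1 t2 c _ ppin) cy off p0; rewrite (rootP ry) eqxx.
Qed.

(** Points that are roots of no remaining polynomial are dropped. A pair t1, t2 that corresponds for
    the shorter list need not do so for [rs]; t1 is replaced by some t1' that does, and a remaining
    polynomial keeps its sign because it has no root between distinct t1 and t1'. *)
Lemma table_sub PP PP' rs : table PP rs -> (forall pp, pp \in PP -> samecoef pp) ->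
  {subset PP' <= PP} -> exists rs', table PP' rs' /\ {subset rs' <= rs}.
Proof.
move=> tab same sub; have [comp sgn rts] := tab.
pose isroot (r : F1 * F2) := has (fun pp : {poly F1} * {poly F2} => (pp.1 != 0) && root pp.1 r.1) PP'.
have subrs : {subset [seq r <- rs | isroot r] <= rs} by move=> r; rewrite mem_filter => /andP[].
exists [seq r <- rs | isroot r]; split => //; split.
- exact: (compat_sub subrs comp).
- move=> t1 t2 c pp ppin'; have ppin := sub _ ppin'.
  have compS := compat_swap comp; have [t1' cS] := corr_exists t2 compS.
  have c' : corr rs t1' t2 by rewrite -corr_swap.
  have E := sgn _ _ c' _ ppin; rewrite /samesign /= -E /=.
  have [->|p0] := eqVneq pp.1 0; first by rewrite !horner0.
  have pos r : r \in rs -> root pp.1 r.1 -> (t1 < r.1) = (t1' < r.1) /\ (r.1 < t1) = (r.1 < t1').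
    move=> rin rr; have rin' : r \in [seq r <- rs | isroot r].
      by rewrite mem_filter rin andbT; apply/hasP; exists pp; rewrite // p0.
    have /corrP/(_ _ rin')[-> ->] := c; have /corrP/(_ _ rin)[-> ->] := c'; by [].
  have noroot x : (t1 <= x <= t1') || (t1' <= x <= t1) -> root pp.1 x -> t1 = t1'.
    move=> xin rx; have [r rin E1] := table_roots tab (same _ ppin) ppin p0 rx.
    have [] := pos r rin; rewrite E1 // => e1 e2.
    have le1 : (t1 <= x) = (t1' <= x) by rewrite !leNgt e2.
    have le2 : (x <= t1) = (x <= t1') by rewrite !leNgt e1.
    have /andP[xle xge] : (t1 <= x) && (x <= t1).
      by case/orP: xin => /andP[h1 h2]; rewrite ?h1 ?h2 ?le1 ?le2 ?h1 ?h2.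
    have e : t1 = x by apply: le_anti; rewrite xle.
    by rewrite {1}e; apply/esym/le_anti; rewrite -le1 -le2 xle.
  have sg0 : root pp.1 t1 \/ root pp.1 t1' -> t1 = t1'.
    by case=> H; apply: (noroot _ _ H); have [h|h] := orP (le_total t1 t1'); rewrite lexx h ?orbT.
  have [r1|n1] := boolP (root pp.1 t1); first by rewrite sg0 //; left.
  have [r2|n2] := boolP (root pp.1 t1'); first by rewrite -sg0 //; right.
  have ivt a b : a <= b -> (forall x, a <= x <= b -> ~~ root pp.1 x) -> sgz pp.1.[a] = sgz pp.1.[b].
    move=> ab nr; apply: contrapT => Ns.
    have [|x xin rx] := @polyrcf.poly_ivt _ pp.1 _ _ ab.
      rewrite leNgt; apply/negP => H; apply: Ns.
      have Ha : pp.1.[a] != 0 by apply: contraTneq H => ->; rewrite mul0r ltxx.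
      apply/eqP; rewrite -subr_eq0; move: H; rewrite -sgz_gt0 sgzM; by do 2!case: sgzP.
    by move: (nr x); rewrite in_itv /= in xin; rewrite xin rx => /(_ isT).
  have [E'|N] := eqVneq t1 t1'; first by rewrite E'.
  have [le|/ltW le] := leP t1 t1'; [|apply: esym]; apply: ivt => // x xin; apply: contraNN N => rx;
    apply/eqP; apply: (noroot x) => //; rewrite xin ?orbT //.
- move=> r; rewrite mem_filter => /andP[/hasP[pp ppin /andP[p0 rr]] _].
  by exists pp.
Qed.

End AddTable.

Section SignDetermination.
Variable A : idomainType.
Implicit Types (Q : seq {poly A}) (p q g : {poly A}).

Definition pairs (F1 F2 : rcfType) (f1 : {rmorphism A -> F1}) (f2 : {rmorphism A -> F2}) Q :=
  [seq (map_poly f1 q, map_poly f2 q) | q : {poly A} <- Q].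

(** L is chosen before the fields and the homomorphisms: this uniformity is what amounts to
    eliminating a quantifier. *)
Definition determined Q := exists L : seq A, forall (F1 F2 : rcfType)
  (f1 : {rmorphism A -> F1}) (f2 : {rmorphism A -> F2}),
  (forall a, a \in L -> samesign (f1 a, f2 a)) -> exists rs, table (pairs f1 f2 Q) rs.

(** Pseudo-division multiplies g by a power of the leading coefficient of q, whose sign is unknown.
    Multiplying by that power once more makes the factor a square. *)
Definition pseudo_rem g q := lead_coef q ^+ scalp g q *: (g %% q).

Lemma pseudo_rem_eq g q : (lead_coef q ^+ scalp g q) ^+ 2 *: g =
  (lead_coef q ^+ scalp g q *: (g %/ q)) * q + pseudo_rem g q.
Proof. by rewrite expr2 -scalerA Pdiv.Idomain.divp_eq scalerDr -scalerAl. Qed.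

Lemma size_pseudo_rem g q : q != 0 -> (size (pseudo_rem g q) < size q)%N.
Proof. by move=> q0; rewrite (leq_ltn_trans (size_scale_leq _ _)) // ltn_modp. Qed.

Lemma sgz_pseudo_rem (F : rcfType) (f : {rmorphism A -> F}) g q x : f (lead_coef q) != 0 ->
  root (map_poly f q) x -> sgz (map_poly f g).[x] = sgz (map_poly f (pseudo_rem g q)).[x].
Proof.
move=> lc rx; have := congr1 (fun p => (map_poly f p).[x]) (pseudo_rem_eq g q).
rewrite /= rmorphD rmorphM /= hornerD hornerM (rootP rx) mulr0 add0r => <-.
rewrite map_polyZ hornerZ.
have pos : 0 < f ((lead_coef q ^+ scalp g q) ^+ 2).
  by rewrite !rmorphXn exprn_even_gt0 //= expf_neq0.
by rewrite sgzM (gtr0_sgz pos) mul1r.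
Qed.

(** A homomorphism may kill leading coefficients of q; the image of q is then that of a truncation
    whose own leading coefficient survives. *)
Definition tails q := [seq take_poly i q | i <- iota 0 (size q).+1].
Definition rems g Q := [seq pseudo_rem g q | q <- [seq q <- flatten (map tails Q) | q != 0]].

(* Hormander's elimination: the signs of g at the roots of the other polynomials are those
   of pseudo-remainders, so g can be traded for polynomials of lower degree. *)
Lemma determined_all n Q : all (fun q : {poly A} => leq (size q) n) Q -> determined Q.
Proof.
elim: n Q => [|n IHn] Q.
  move=> /allP H; exists [::] => F1 F2 f1 f2 _; exists [::]; split => // t1 t2 _ pp /mapP[q qin ->].
  have /eqP-> : q == 0 by rewrite -size_poly_eq0 -leqn0; exact: H.
  by rewrite /samesign /= !rmorph0 !horner0 !sgz0.
(* The inner induction is on the number of polynomials of possibly maximal size n + 1. Trading g for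
   polynomials of size at most n lowers it, however many of these there are. *)
suff H k : forall Ql Qt, all (fun q : {poly A} => leq (size q) n) Ql ->
    all (fun q : {poly A} => leq (size q) n.+1) Qt -> size Qt = k -> determined (Ql ++ Qt).
  by move=> HQ; apply: (H (size Q) [::] Q).
elim: k => [|k IHk] Ql [|g Qt] // sl st; first by rewrite cats0 => _; exact: IHn.
move=> /= [sk]; move: st => /= /andP[sg st].
(* The truncation replaces g when its coefficient of degree n maps to 0; otherwise the derivative
   allows [table_add]. *)
pose low := [:: take_poly n g; g^`()].
pose B := Ql ++ low ++ Qt.
have slow : all (fun q : {poly A} => leq (size q) n) low.
  rewrite /= size_take_poly andbT /=; have [->|g0] := eqVneq g 0; first by rewrite derivC size_poly0.
  by rewrite -ltnS; apply: leq_trans sg; exact: lt_size_deriv.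
have sB : all (fun q : {poly A} => leq (size q) n.+1) B.
  rewrite !all_cat st andbT; apply/andP; split; [move: sl|move: slow];
  by apply: sub_all => q /leqW.
have srem : all (fun q : {poly A} => leq (size q) n) (rems g B).
  apply/allP => _ /mapP[q + ->]; rewrite mem_filter => /andP[q0 /flatten_mapP[p pB /mapP[i _ Eq]]].
  rewrite -ltnS (leq_trans (size_pseudo_rem _ q0)) // Eq.
  apply: leq_trans (allP sB _ pB).
  have [le|/ltnW le] := leqP (size p) i; first by rewrite take_poly_id.
  by rewrite (leq_trans (size_take_poly _ _)).
have [|L HL] := IHk (Ql ++ low ++ rems g B) Qt _ st sk.
  by rewrite !all_cat sl slow.
exists (L ++ flatten [seq polyseq q | q <- g :: Ql ++ low ++ rems g B ++ Qt]) => F1 F2 f1 f2 fL.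
have coefQ q : q \in g :: Ql ++ low ++ rems g B ++ Qt -> samecoef (map_poly f1 q, map_poly f2 q).
  move=> qin i; rewrite /samesign /= !coef_map; have [lt|ge] := ltnP i (size q).
    apply: (fL q`_i); rewrite mem_cat; apply/orP; right; apply/flatten_mapP.
    by exists q => //; rewrite mem_nth.
  by rewrite nth_default // !raddf0 !sgz0.
have [rs tab] : exists rs, table (pairs f1 f2 ((Ql ++ low ++ rems g B) ++ Qt)) rs.
  by apply: HL => a aL; apply: fL; rewrite mem_cat aL.
have subQ q : q \in (Ql ++ low ++ rems g B) ++ Qt -> q \in g :: Ql ++ low ++ rems g B ++ Qt.
  by rewrite inE -!catA => ->; rewrite orbT.
have samep Q' : (forall q, q \in Q' -> q \in g :: Ql ++ low ++ rems g B ++ Qt) ->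
    forall pp, pp \in pairs f1 f2 Q' -> samecoef pp.
  by move=> H pp /mapP[q qin ->]; apply: coefQ; exact: H.
pose gg := (map_poly f1 g, map_poly f2 g).
have sameg : samecoef gg by apply: coefQ; rewrite inE eqxx.
suff [rs' tab'] : exists rs', table (gg :: pairs f1 f2 B) rs'.
  have [||rs'' [tab'' _]] := table_sub (PP' := pairs f1 f2 (Ql ++ g :: Qt)) tab'.
  - move=> pp; rewrite inE => /orP[/eqP->//|]; apply: samep => q.
    by rewrite inE !mem_cat => /or3P[->|->|->]; rewrite ?orbT.
  - move=> pp /mapP[q qin ->]; move: qin; rewrite mem_cat inE => /or3P[qin|/eqP->|qin].
    + by rewrite inE; apply/orP; right; apply: map_f; rewrite mem_cat qin.
    + by rewrite inE eqxx.
    + by rewrite inE; apply/orP; right; apply: map_f; rewrite !mem_cat qin !orbT.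
  by exists rs''.
have [||rs0 [tab0 sub0]] := table_sub (PP' := pairs f1 f2 B) tab.
- by apply: samep => q /subQ.
- move=> pp /mapP[q qin ->]; apply: map_f; move: qin; rewrite !mem_cat.
  by move=> /or3P[->|->|->]; rewrite ?orbT.
have gn : g = take_poly n g + g`_n *: 'X^n.
  apply/polyP => i; rewrite coefD coef_take_poly coefZ coefXn.
  have [lt|gt|->] := ltngtP i n; rewrite ?mulr0 ?mulr1 ?addr0 ?add0r //.
  by rewrite nth_default // (leq_trans sg).
have [c0|c0] := eqVneq (f1 g`_n) 0.
  have c20 : f2 g`_n = 0 by apply/eqP; have := samesign_eq0 (sameg n); rewrite /= !coef_map /= c0 eqxx => <-.
  have ggE : gg = (map_poly f1 (take_poly n g), map_poly f2 (take_poly n g)).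
    by rewrite /gg {1 2}gn !rmorphD /= !map_polyZ c0 c20 !scale0r !addr0.
  exists rs0; have [comp sgn rts] := tab0; split => //.
    move=> t1 t2 c pp; rewrite inE => /orP[/eqP->|]; last exact: sgn.
    by apply: sgn => //; rewrite ggE; apply: map_f; rewrite !mem_cat inE eqxx ?orbT.
  by move=> r /rts[pp ppin H]; exists pp; rewrite // inE ppin orbT.
apply: (table_add tab0) => //.
  rewrite /= !deriv_map; apply: (map_f (fun q => (map_poly f1 q, map_poly f2 q))).
  by rewrite !mem_cat !inE eqxx !orbT.
move=> r rin; have [comp0 sgn0 rts0] := tab0.
have [_ /mapP[q qB ->] /= [q0 rq]] := rts0 _ rin.
have sameq : samecoef (map_poly f1 q, map_poly f2 q).
  by apply: coefQ; move: qB; rewrite inE !mem_cat => /or3P[->|->|->]; rewrite ?orbT.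
have rq2 : root (map_poly f2 q) r.2.
  apply/eqP; have := sgn0 _ _ (comp0 _ rin) _ (map_f _ qB) => /samesign_eq0.
  by rewrite /= (rootP rq) eqxx => /esym/eqP.
(* q' is cut to the size of the image of q, which is the same in both fields, so its leading
   coefficient is nonzero in both and the pseudo-remainder decides the sign of g. *)
pose i := size (map_poly f1 q); pose q' := take_poly i q.
have i0 : (0 < i)%N by rewrite size_poly_gt0.
have iq : (i <= size q)%N by exact: size_poly.
have i2 : i = size (map_poly f2 q) by exact: (samecoef_size sameq).
have mapq' (F : rcfType) (f : {rmorphism A -> F}) : size (map_poly f q) = i -> map_poly f q' = map_poly f q.
  move=> E; apply/polyP => j; rewrite !coef_map /= coef_take_poly; case: ltnP => // ge.
  by rewrite rmorph0 -coef_map nth_default // E.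
have lead (F : rcfType) (f : {rmorphism A -> F}) : size (map_poly f q) = i -> f q`_i.-1 != 0.
  move=> E; rewrite -coef_map -E -lead_coefE lead_coef_eq0 -size_poly_gt0 E; exact: i0.
have qi : q`_i.-1 != 0 by apply: contraNneq (lead _ f1 erefl) => ->; rewrite rmorph0.
have sq' : size q' = i.
  apply/eqP; rewrite eqn_leq size_take_poly /= leqNgt; apply/negP => lt.
  have : q'`_i.-1 = 0 by rewrite nth_default // -ltnS prednK.
  by rewrite coef_take_poly ltn_predL i0 => /eqP; rewrite (negPf qi).
have lq' : lead_coef q' = q`_i.-1.
  by rewrite lead_coefE sq' coef_take_poly ltn_predL i0.
have rem_in : pseudo_rem g q' \in rems g B.
  apply: map_f; rewrite mem_filter -size_poly_gt0 sq' i0 /=.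
  by apply/flatten_mapP; exists q => //; apply/mapP; exists i; rewrite // mem_iota /= add0n ltnS.
have [comp sgn _] := tab.
rewrite /samesign /= (@sgz_pseudo_rem _ f1 g q') ?lq' ?lead // ?mapq' //.
rewrite (@sgz_pseudo_rem _ f2 g q') ?lq' ?lead // ?mapq' //.
have := sgn _ _ (comp _ (sub0 _ rin)) (map_poly f1 (pseudo_rem g q'), map_poly f2 (pseudo_rem g q')).
by apply; apply: map_f; rewrite !mem_cat rem_in !orbT.
Qed.

Theorem sign_determination Q : exists L : seq A, forall (F1 F2 : rcfType)
  (f1 : {rmorphism A -> F1}) (f2 : {rmorphism A -> F2}),
  (forall a, a \in L -> samesign (f1 a, f2 a)) -> forall t1, exists t2,
  forall q, q \in Q -> samesign ((map_poly f1 q).[t1], (map_poly f2 q).[t2]).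
Proof.
have [|L HL] := @determined_all (\max_(q <- Q) size q) Q.
  by apply/allP => q qin; exact: leq_bigmax_seq.
exists L => F1 F2 f1 f2 /HL[rs [comp sgn _]] t1.
have [t2 c] := corr_exists t1 comp; exists t2 => q qin.
exact: (sgn _ _ c _ (map_f _ qin)).
Qed.

End SignDetermination.

(** * Iterated polynomial rings and Tarski transfer *)

Fixpoint iter_poly (B : idomainType) k : idomainType :=
  if k is k'.+1 then {poly (iter_poly B k')} else B.

Fixpoint icst (B : idomainType) k : {rmorphism B -> iter_poly B k} :=
  match k return {rmorphism B -> iter_poly B k} with
  | 0 => idfun
  | k'.+1 => (@polyC (iter_poly B k')) \o (icst B k')
  end.

Fixpoint ivar (B : idomainType) k (i : nat) : iter_poly B k :=
  match k return iter_poly B k with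
  | 0 => 0
  | k'.+1 => if i == k' then 'X else (ivar B k' i)%:P
  end.

Fixpoint ieval (B : idomainType) (F : comNzRingType) (f : {rmorphism B -> F}) (a : nat -> F) k :
    {rmorphism iter_poly B k -> F} :=
  match k return {rmorphism iter_poly B k -> F} with
  | 0 => f
  | k'.+1 => (horner_eval (a k')) \o (map_poly (ieval f a k'))
  end.

Section Iterp.
Variables (B : idomainType).

Lemma ieval_cst (F : comNzRingType) (f : {rmorphism B -> F}) a k b : ieval f a k (icst B k b) = f b.
Proof.
elim: k => //= k IH.
by rewrite map_polyC /= /horner_eval hornerC; exact: IH.
Qed.

Lemma ieval_var (F : comNzRingType) (f : {rmorphism B -> F}) a k i : (i < k)%N ->
  ieval f a k (ivar B k i) = a i.
Proof.
elim: k => //= k IH; rewrite ltnS leq_eqVlt /horner_eval.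
have [->|_ /= lt] := eqVneq i k; first by rewrite map_polyX hornerX.
by rewrite map_polyC hornerC; exact: IH.
Qed.

Lemma eq_ieval (F : comNzRingType) (f : {rmorphism B -> F}) a a' k :
  (forall i, (i < k)%N -> a i = a' i) -> ieval f a k =1 ieval f a' k.
Proof.
elim: k => //= k IH H p; rewrite /horner_eval H //; congr (_.[_]).
by apply: eq_map_poly; apply: IH => i ik; apply: H; exact: leqW.
Qed.

Lemma iter_poly_countable (e : B -> nat) k : injective e -> exists e' : iter_poly B k -> nat, injective e'.
Proof.
move=> inje; elim: k => [|k [e' inje']] /=; first by exists e.
exists (fun p => pickle (map e' (polyseq p))) => p q /(pcan_inj pickleK)/(inj_map inje').
exact: val_inj.
Qed.

(** Variables are eliminated one at a time, down to conditions on B; the coordinates a are then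
    found in the opposite order. The point of F1 is given as a homomorphism phi, its coordinates
    being the images of the variables. *)
Theorem sign_transfer k (Q : seq (iter_poly B k)) : exists L : seq B,
  forall (F1 F2 : rcfType) (phi : {rmorphism iter_poly B k -> F1}) (f2 : {rmorphism B -> F2}),
  (forall b, b \in L -> samesign (phi (icst B k b), f2 b)) ->
  exists a, forall q, q \in Q -> samesign (phi q, ieval f2 a k q).
Proof.
elim: k Q => [|k IH] /= Q; first by exists Q => F1 F2 phi f2 H; exists (fun=> 0).
have [L1 H1] := sign_determination Q; have [L H] := IH L1.
exists L => F1 F2 phi f2 fL.
have [a aL1] := H F1 F2 (phi \o polyC) f2 fL.
have [t2 Ht] := H1 F1 F2 (phi \o polyC) (ieval f2 a k) aL1 (phi 'X).
exists (fun i => if i == k then t2 else a i) => q qQ; have := Ht q qQ.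
have -> : (map_poly (phi \o polyC) q).[phi 'X] = phi q.
  rewrite -[in RHS](coefK q) poly_def rmorph_sum horner_poly /=.
  by apply: eq_bigr => i _; rewrite -mul_polyC rmorphM rmorphXn.
rewrite /horner_eval eqxx; congr (samesign (_, _.[_])).
apply: eq_map_poly; apply: eq_ieval => i ik; by rewrite ltn_eqF.
Qed.

End Iterp.

(** * Restriction of polynomials to lines through a base point *)

Section Ptr.
Variables (n : nat).
Implicit Types (p q : Poly n) (x : Rn n).

Fixpoint poly_map_eval (B : comNzRingType) (cst : R -> B) (xs : Fin.t n -> B) p : B :=
  match p with
  | PConst c => cst c
  | PVar i => xs i
  | PAdd p q => poly_map_eval cst xs p + poly_map_eval cst xs q
  | PMul p q => poly_map_eval cst xs p * poly_map_eval cst xs q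
  end.

Fixpoint consts p : seq R :=
  match p with
  | PConst c => [:: c]
  | PVar _ => [::]
  | PAdd p q | PMul p q => consts p ++ consts q
  end.

Lemma pevalE p x : peval p x = poly_map_eval id x p.
Proof. by elim: p => //= p -> q ->. Qed.

(** Compatibility is asked only at the constants of p: later, real constants are encoded by
    variables, which is faithful only on a finite list. *)
Lemma poly_map_eval_morph (B C : comNzRingType) (phi : {rmorphism B -> C}) cst cst' xs xs' p :
  (forall c, c \in consts p -> phi (cst c) = cst' c) -> (forall i, phi (xs i) = xs' i) ->
  phi (poly_map_eval cst xs p) = poly_map_eval cst' xs' p.
Proof.
move=> + Hx; elim: p => //= [c|p IHp q IHq|p IHp q IHq] H.
- by rewrite H // inE.
- by rewrite rmorphD IHp ?IHq // => c cin; apply: H; rewrite mem_cat cin ?orbT.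
- by rewrite rmorphM IHp ?IHq // => c cin; apply: H; rewrite mem_cat cin ?orbT.
Qed.

Variable x0 : Rn n.
Definition pt (z : Rn n) (t : R) : Rn n := fun i => z i + t * (x0 i - z i).

Definition line p (z : Rn n) : {poly R} :=
  poly_map_eval (fun c => c%:P) (fun i => (z i)%:P + (x0 i - z i)%:P * 'X) p.

Lemma lineE p z t : (line p z).[t] = peval p (pt z t).
Proof.
rewrite pevalE -/(horner_eval t _).
apply: poly_map_eval_morph => [c _|i]; rewrite /= /horner_eval !hornerE //.
by rewrite mulrC.
Qed.

(* The coefficients, as polynomials in z, of the restriction [line p z]. *)
Fixpoint lcoef p (j : nat) : Poly n :=
  match p with
  | PConst c => PConst (if j is 0 then c else 0)
  | PVar i => match j with
              | 0 => PVar i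
              | 1 => PAdd (PConst (x0 i)) (PMul (PConst (-1)) (PVar i))
              | _ => PConst 0 end
  | PAdd p q => PAdd (lcoef p j) (lcoef q j)
  | PMul p q => foldr PAdd (PConst 0) [seq PMul (lcoef p k) (lcoef q (j - k)) | k <- iota 0 j.+1]
  end.

Lemma lcoefE p z j : peval (lcoef p j) z = (line p z)`_j.
Proof.
elim: p j => [c|i|p IHp q IHq|p IHp q IHq] j.
- by rewrite /line /= coefC; case: j.
- rewrite /line /= coefD coefC coefCM coefX.
  case: j => [|[|j]] /=; rewrite ?mulr0 ?mulr1 ?addr0 ?add0r //.
  by rewrite RplusE RmultE mulN1r.
- by rewrite /line /= RplusE IHp IHq coefD.
- have -> : line (PMul p q) z = line p z * line q z by [].
  have -> : lcoef (PMul p q) j =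
    foldr PAdd (PConst 0) [seq PMul (lcoef p k) (lcoef q (j - k)) | k <- iota 0 j.+1] by [].
  rewrite coefM -(big_mkord xpredT (fun k => (line p z)`_k * (line q z)`_(j - k))).
  rewrite /index_iota subn0.
  elim: (iota 0 j.+1) => [|k s IH]; first by rewrite big_nil.
  by rewrite big_cons /= IH IHp IHq.
Qed.

(** Bounds the number of coefficients of [line p z] uniformly in z. *)
Fixpoint pdeg p : nat :=
  match p with
  | PConst _ => 1
  | PVar _ => 2
  | PAdd p q => maxn (pdeg p) (pdeg q)
  | PMul p q => pdeg p + pdeg q
  end.

Lemma size_line p z : (size (line p z) <= pdeg p)%N.
Proof.
rewrite /line; elim: p => [c|i|p IHp q IHq|p IHp q IHq] /=.
- exact: size_polyC_leq1.
- rewrite (leq_trans (size_polyD _ _)) // geq_max (leq_trans (size_polyC_leq1 _)) //=.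
  by rewrite mul_polyC (leq_trans (size_scale_leq _ _)) // size_polyX.
- by rewrite (leq_trans (size_polyD _ _)) // geq_max !leq_max IHp IHq orbT.
- by rewrite (leq_trans (size_polyMleq _ _)) // (leq_trans (leq_pred _)) // leq_add.
Qed.

(** At parameter 1 the line reaches x0. Hence the coefficients have no common zero z when p(x0) is
    nonzero: the strata cover the space. *)
Lemma sum_lcoef p z : \sum_(j < pdeg p) peval (lcoef p j) z = peval p x0.
Proof.
have -> : peval p x0 = (line p z).[1].
  rewrite lineE; congr (peval p _); apply: funext => i.
  by rewrite /pt mul1r addrC subrK.
rewrite (horner_coef_wide _ (size_line p z)).
by apply: eq_bigr => j _; rewrite lcoefE expr1n mulr1.
Qed.

End Ptr.

Definition nbhs_Rn n (x : Rn n) : set_system (Rn n) :=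
  [set A | exists2 d : R, 0 < d & forall y, (forall i, `|y i - x i| < d) -> A y].

Instance nbhs_Rn_filter n (x : Rn n) : ProperFilter (nbhs_Rn x).
Proof.
split.
  by move=> [d d0 /(_ x)]; apply => i; rewrite subrr normr0.
split.
- by exists 1.
- move=> A B [d d0 HA] [e e0 HB]; exists (Num.min d e); first by rewrite lt_min d0.
  move=> y Hy; split; [apply: HA|apply: HB] => i; have := Hy i; rewrite lt_min => /andP[//].
- by move=> A B AB [d d0 HA]; exists d => // y /HA /AB.
Qed.

(** * Rational functions on strata *)

Lemma fin_bounded n (g : Fin.t n -> R) : exists2 M : R, 0 < M & forall i, `|g i| < M.
Proof.
elim: n g => [|n IH] g; first by exists 1 => // i; exact: (Fin.case0 (fun i => `|g i| < 1) i).
have [M M0 HM] := IH (g \o Fin.FS).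
exists (Num.max M (`|g Fin.F1| + 1)); first by rewrite lt_max M0.
move=> i; apply: (Fin.caseS' i (fun i => `|g i| < _)); first by rewrite lt_max ltrDl ltr01 orbT.
by move=> j; rewrite lt_max; have := HM j => /= ->.
Qed.

(* The topology and norm lemmas apply to [R] only through its [realType] structure. *)
Definition Rreal : realType := R.

Definition cont n (h : Rn n -> Rreal) (x : Rn n) := h @ nbhs_Rn x --> h x.

Section Cont.
Variable n : nat.
Implicit Types (g h : Rn n -> Rreal) (x : Rn n).

Lemma cont_dist h x : cont h x <->
  forall e : Rreal, 0 < e -> \forall y \near nbhs_Rn x, `|h x - h y| < e.
Proof. exact: cvgrPdist_lt. Qed.

Lemma contP h : continuous_Rn h <-> forall x, cont h x.
Proof.
split=> [H x|H x eps /RltP eps0].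
  apply/cont_dist => e e0; have /RltP e1 := e0; have [d [/RltP d0 Hd]] := H x e e1.
  exists d => // y Hy; rewrite distrC -RabsE -RminusE; apply/RltP; apply: Hd => i.
  by apply/RltP; rewrite RabsE RminusE; exact: Hy.
have [d d0 Hd] := (cont_dist _ _).1 (H x) _ eps0.
exists d; split; first exact/RltP.
move=> y Hy; apply/RltP; rewrite RabsE RminusE distrC; apply: Hd => i.
by move/RltP: (Hy i); rewrite RabsE RminusE.
Qed.

Lemma cont_cst (c : R) x : cont (fun=> c) x.
Proof. exact: cvg_cst. Qed.

Lemma cont_coord i x : cont (fun y => y i) x.
Proof.
apply/cont_dist => e e0; exists e => // y Hy; by rewrite distrC.
Qed.

Lemma contD g h x : cont g x -> cont h x -> cont (fun y => g y + h y) x.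
Proof. by move=> cg ch; exact: cvgD. Qed.
Lemma contM g h x : cont g x -> cont h x -> cont (fun y => g y * h y) x.
Proof. by move=> cg ch; exact: cvgM. Qed.
Lemma contN g x : cont g x -> cont (fun y => - g y) x.
Proof. by move=> cg; exact: cvgN. Qed.
Lemma contV g x : g x != 0 -> cont g x -> cont (fun y => (g y)^-1) x.
Proof. by move=> g0 cg; exact: cvgV. Qed.

Lemma cont_peval p x : cont (peval p) x.
Proof.
elim: p => [c|i|p IHp q IHq|p IHp q IHq] /=.
- exact: cont_cst.
- exact: cont_coord.
- exact: contD.
- exact: contM.
Qed.

Lemma cont_near g h x : (\forall y \near nbhs_Rn x, g y = h y) -> cont g x -> g x = h x -> cont h x.
Proof. by rewrite /cont => E cg <-; apply: cvg_trans cg; apply: near_eq_cvg. Qed.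

Lemma cont_neq0 g x : cont g x -> g x != 0 -> \forall y \near nbhs_Rn x, g y != 0.
Proof.
move=> cg g0; have : 0 < `|g x| by rewrite normr_gt0.
move=> /((cont_dist _ _).1 cg); apply: filterS => y; apply: contraTneq => ->.
by rewrite subr0 ltxx.
Qed.

Lemma cont_gt0 g x : cont g x -> 0 < g x -> \forall y \near nbhs_Rn x, 0 < g y.
Proof.
move=> cg g0; have := (cont_dist _ _).1 cg _ g0; apply: filterS => y.
by rewrite ltr_distlC => /andP[]; rewrite subrr.
Qed.

(* Restricted to the line through z and x0, q is a nonzero univariate polynomial. *)
Lemma dense_nonzero (q : Poly n) x0 z (A : set (Rn n)) : peval q x0 != 0 -> nbhs_Rn z A ->
  exists2 y, A y & peval q y != 0.
Proof.
move=> q0 [d d0 Ad].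
have l0 : line x0 q z != 0.
  apply: contraNneq q0 => l0; have := lineE x0 q z 1; rewrite l0 horner0 => ->.
  by apply/eqP; congr (peval q _); apply: funext => i; rewrite /pt mul1r addrC subrK.
have [M M0 HM] : exists2 M : R, 0 < M & forall i, `|x0 i - z i| < M.
  exact: fin_bounded.
have [t /andP[t0 td] nt] := nonroot_between l0 (divr_gt0 d0 M0).
exists (pt x0 z t); last by rewrite -lineE.
apply: Ad => i; rewrite /pt addrAC subrr add0r normrM gtr0_norm //.
rewrite (le_lt_trans (_ : _ <= t * M)) ?ler_pM2l ?ltW //.
by rewrite -ltr_pdivlMr.
Qed.

Lemma dense_eq (q : Poly n) x0 g h x : peval q x0 != 0 ->
  (forall y, peval q y != 0 -> g y = h y) -> cont g x -> cont h x -> g x = h x.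
Proof.
move=> q0 E cg ch; apply/eqP; rewrite -subr_eq0; apply: contrapT => /negP d0.
have [y + qy] := dense_nonzero q0 (cont_neq0 (contD cg (contN ch)) d0).
by rewrite E // subrr eqxx.
Qed.

End Cont.

Arguments cont_peval {n} p x.
Arguments cont_cst {n} c x.

Lemma horner_cvg (P : {poly Rreal}) (x : Rreal) : P.[t] @[t --> x] --> P.[x].
Proof.
elim/poly_ind: P => [|P c IH].
  by under eq_fun do rewrite horner0; rewrite horner0; exact: cvg_cst.
under eq_fun do rewrite hornerMXaddC; rewrite hornerMXaddC.
by apply: cvgD; [apply: cvgM|exact: cvg_cst].
Qed.

Section Strata.
Variables (n : nat) (f : Rn n -> Rreal) (p q : Poly n) (x0 : Rn n).
Hypothesis fcont : forall x, cont f x.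
Hypothesis q0 : peval q x0 != 0.
Hypothesis fE : forall x, peval q x != 0 -> f x * peval q x = peval p x.

Lemma f_mul_q x : f x * peval q x = peval p x.
Proof.
apply: (@dense_eq n q x0 (fun x => f x * peval q x) (peval p)) => //.
  by apply: contM => //; exact: cont_peval.
exact: cont_peval.
Qed.

Lemma pt_cvg (z : Rn n) (A : set (Rn n)) : nbhs_Rn z A -> \forall t \near (0 : Rreal)^', A (pt x0 z t).
Proof.
move=> [d d0 Ad]; have [M M0 HM] := fin_bounded (fun i => x0 i - z i).
have dM : 0 < d / M by rewrite divr_gt0.
exists (d / M) => //= t; rewrite /ball /= sub0r normrN => td _.
apply: Ad => i; rewrite /pt addrAC subrr add0r normrM.
by apply: le_lt_trans (_ : `|t| * M < d); [rewrite ler_wpM2l // ltW|rewrite -ltr_pdivlMr].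
Qed.

(** By induction the p_i with i < j vanish at z as well, so along the line both p and q are
    divisible by t^j. Cancelling t^j in f q = p and letting t tend to 0 gives the claim, f being
    continuous at z. *)
Lemma strata z j : (forall i, (i < j)%N -> peval (lcoef x0 q i) z = 0) ->
  f z * peval (lcoef x0 q j) z = peval (lcoef x0 p j) z.
Proof.
elim/ltn_ind: j => j IH qlow.
have plow i : (i < j)%N -> peval (lcoef x0 p i) z = 0.
  move=> ij; rewrite -IH ?qlow ?mulr0 // => k ki; apply: qlow; exact: ltn_trans ki ij.
have split (P : Poly n) : (forall i, (i < j)%N -> peval (lcoef x0 P i) z = 0) ->
    exists2 P' : {poly R}, line x0 P z = P' * 'X^j & P'.[0] = peval (lcoef x0 P j) z.
  move=> low; exists (drop_poly j (line x0 P z)).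
    rewrite -[LHS](poly_take_drop j) (_ : take_poly _ _ = 0) ?add0r //.
    by apply/polyP => i; rewrite coef_take_poly coef0; case: ltnP => // ij; rewrite -lcoefE low.
  by rewrite horner_coef0 coef_drop_poly add0n lcoefE.
have [Q' EQ <-] := split q qlow; have [P' EP <-] := split p plow.
have cf : f (pt x0 z t) @[t --> (0 : Rreal)^'] --> (f z : Rreal).
  by move=> A fA; exact: (pt_cvg (fcont fA)).
have cQ (P : {poly Rreal}) : P.[t] @[t --> (0 : Rreal)^'] --> P.[0].
  by move=> A /(@horner_cvg P 0); exact: nbhs_dnbhs.
have c1 : f (pt x0 z t) * Q'.[t] @[t --> (0 : Rreal)^'] --> f z * Q'.[0].
  by apply: cvgM cf (cQ Q'); exact: dnbhs_filter.
have c2 : f (pt x0 z t) * Q'.[t] @[t --> (0 : Rreal)^'] --> P'.[0].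
  apply: cvg_trans (cQ P'); apply: near_eq_cvg; near=> t.
have t0 : t != 0 by near: t; exact: nbhs_dnbhs_neq.
have := f_mul_q (pt x0 z t); rewrite -!lineE EQ EP !hornerM hornerXn mulrA.
by move/(mulIf (expf_neq0 _ t0)).
exact: (@norm_cvg_unique Rreal Rreal _ _ _ _ c1 c2).
Unshelve. all: by end_near.
Qed.

End Strata.

(** * The Lojasiewicz inequality *)

Section Germ.
Variable F : realFieldType.

Lemma poly_bounded (a : {poly F}) : exists2 C, 0 < C & forall s, 0 <= s <= 1 -> `|a.[s]| <= C.
Proof.
elim/poly_ind: a => [|a c [C C0 H]].
  by exists 1 => // s _; rewrite horner0 normr0.
exists (C + `|c|); first by rewrite ltr_pwDl.
move=> s s01; rewrite hornerMXaddC (le_trans (ler_normD _ _)) // lerD2r normrM.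
have /andP[s0 s1] := s01.
by rewrite (ger0_norm s0) (le_trans (ler_piMr _ s1)) // H.
Qed.

(** eps is the sign of a just to the right of 0. The explicit bound s^m, and not the sign alone,
    feeds the two-variable estimate that follows. *)
Lemma poly_germ (a : {poly F}) : a != 0 -> exists m s0 eps, [/\ 0 < s0 :> F, s0 <= 1, eps * eps = 1 :> F &
  forall s, 0 < s < s0 -> s ^+ m <= eps * a.[s]].
Proof.
elim/poly_ind: a => [|a c IH]; first by rewrite eqxx.
have [->|c0] := eqVneq c 0 => a0.
  have [|m [s0 [eps [s00 s01 eps2 H]]]] := IH.
    by apply: contraNneq a0 => ->; rewrite mul0r addr0.
  exists m.+1, s0, eps; split => // s /andP[sgt slt].
  by rewrite hornerMXaddC addr0 mulrA exprSr ler_pM2r // H // sgt.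
have [C C0 HC] := poly_bounded a.
have nc : 0 < `|c| by rewrite normr_gt0.
(* Below this bound s (C + 1) is less than the absolute value of c, so the constant term exceeds C s
   by more than s. *)
pose s0 := Num.min 1 (`|c| / (2 * (C + 1))).
have s00 : 0 < s0 by rewrite lt_min ltr01 divr_gt0 // mulr_gt0 // addr_gt0.
exists 1, s0, (Num.sg c); split => //; first by rewrite ge_min lexx.
  by rewrite -expr2 sqr_sg c0.
move=> s /andP[sgt]; rewrite lt_min => /andP[s1].
rewrite ltr_pdivlMr ?mulr_gt0 ?addr_gt0 // => sc.
rewrite hornerMXaddC mulrDr -normrEsg expr1.
have := HC s; rewrite (ltW sgt) (ltW s1) => /(_ isT) Ha.
have : - (C * s) <= Num.sg c * (a.[s] * s).
  rewrite lerNl -mulrN; apply: le_trans (ler_norm _) _.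
  by rewrite normrM normrN normrM normr_sg c0 mul1r (gtr0_norm sgt) ler_pM2r.
by nra.
Qed.

(* The region where s is small and v is at least a large negative power of s. *)
Lemma poly2_germ (b : {poly {poly F}}) : b != 0 ->
  exists N m s0 eps, [/\ 0 < s0 :> F, s0 <= 1, eps * eps = 1 :> F &
  forall s v, 0 < s < s0 -> 0 < v -> 1 <= v * s ^+ N -> s ^+ m <= eps * b.[v%:P].[s]].
Proof.
elim/poly_ind: b => [|b a IH]; first by rewrite eqxx.
have [->|b0] := eqVneq b 0.
  rewrite mul0r add0r polyC_eq0 => /poly_germ[m [s0 [eps [s00 s01 eps2 H]]]].
  by exists 0, m, s0, eps; split => // s v sin _ _; rewrite hornerC H.
move=> _; have [N [m [s0 [eps [s00 s01 eps2 H]]]]] := IH b0.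
have [C C0 HC] := poly_bounded a.
have neps x : `|eps * x| = `|x|.
  rewrite normrM (_ : `|eps| = 1) ?mul1r //; apply/eqP.
  by rewrite -(@eqrXn2 _ 2) // -normrX expr2 eps2 normr1 expr1n.
(* From v s^(m+1) >= 1 and s < 1 / (C + 1) follows s^m v >= 1 / s > C + 1, so the term with v beats
   the coefficient a by at least 1 = s^0. *)
exists (maxn N m.+1), 0, (Num.min s0 (C + 1)^-1), eps; split=> //.
- by rewrite lt_min s00 invr_gt0 addr_gt0.
- by rewrite ge_min s01.
move=> s v /andP[sgt]; rewrite lt_min => /andP[slt sC] v0 vN.
have s1 : s < 1 by exact: lt_le_trans s01.
have pw k : (k <= maxn N m.+1)%N -> 1 <= v * s ^+ k.
  move=> kN; apply: le_trans vN _; rewrite ler_pM2l //.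
  by apply: ler_wiXn2l; rewrite ?ltW.
have := H s v; rewrite sgt slt => /(_ isT v0 (pw N (leq_maxl _ _))) Hb.
rewrite expr0 hornerMXaddC hornerD hornerM !hornerC mulrDr.
have Ha : - C <= eps * a.[s].
  by rewrite lerNl; apply: le_trans (ler_norm _) _; rewrite normrN neps HC // !ltW.
have big : C + 1 <= eps * b.[v%:P].[s] * v.
  have h1 : s ^+ m * v <= eps * b.[v%:P].[s] * v by rewrite ler_pM2r.
  apply: le_trans h1.
  have h2 := pw m.+1 (leq_maxr _ _).
  have C1 : 0 < C + 1 by rewrite addr_gt0.
  have : (C + 1) * s <= 1 by rewrite -ler_pdivlMl // mulr1 ltW.
  rewrite -(ler_pM2r sgt) => h4; apply: le_trans h4 _.
  by move: h2; rewrite exprSr mulrA [v * _]mulrC.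
by move: big Ha; rewrite mulrA; lra.
Qed.

Definition sgz_const (b : {poly {poly F}}) N s0 := exists sigma : int,
  forall s v : F, 0 < s < s0 -> 0 < v -> 1 <= v * s ^+ N -> sgz b.[v%:P].[s] = sigma.

Lemma sgz_const_weak b N s0 N' s0' : sgz_const b N s0 -> (N <= N')%N -> s0' <= s0 -> s0' <= 1 ->
  sgz_const b N' s0'.
Proof.
move=> [sigma H] NN ss s1; exists sigma => s v /andP[sgt slt] v0 vN.
apply: H => //; first by rewrite sgt (lt_le_trans slt).
apply: le_trans vN _; rewrite ler_pM2l //.
by apply: ler_wiXn2l; rewrite ?ltW // (lt_le_trans slt).
Qed.

Lemma germ_signs (L : seq {poly {poly F}}) : exists N s0, [/\ 0 < s0, s0 <= 1 &
  forall b, b \in L -> sgz_const b N s0].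
Proof.
elim: L => [|b L [N [s0 [s00 s01 H]]]]; first by exists 0, 1; rewrite ltr01 lexx.
have [N' [s0' [s00' s01' Hb]]] : exists N s0, [/\ 0 < s0, s0 <= 1 & sgz_const b N s0].
  have [->|b0] := eqVneq b 0.
    by exists 0, 1; split=> //; exists 0 => s v _ _ _; rewrite !horner0 sgz0.
  have [N' [m [s0' [eps [s00' s01' eps2 Hb]]]]] := poly2_germ b0.
  exists N', s0'; split => //; exists (sgz eps) => s v sin v0 vN.
  have : 0 < eps * b.[v%:P].[s].
    by apply: lt_le_trans (Hb s v sin v0 vN); rewrite exprn_gt0 //; case/andP: sin.
  move=> pos; have -> : b.[v%:P].[s] = eps * (eps * b.[v%:P].[s]) by rewrite mulrA eps2 mul1r.
  by rewrite sgzM (gtr0_sgz pos) mulr1.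
exists (maxn N N'), (Num.min s0 s0'); split.
- by rewrite lt_min s00.
- by rewrite ge_min s01.
move=> c; rewrite inE => /orP[/eqP->|cL].
  by apply: (sgz_const_weak Hb); rewrite ?leq_maxr ?ge_min ?lexx ?s01 ?orbT.
by apply: (sgz_const_weak (H c cL)); rewrite ?leq_maxl ?ge_min ?lexx ?s01 ?orbT.
Qed.

End Germ.

Lemma fin_filter n T (G : set_system T) (A : Fin.t n -> set T) : Filter G ->
  (forall i, G (A i)) -> G [set t | forall i, A i t].
Proof.
move=> FG; elim: n A => [|n IH] A GA.
  apply: (@filterS _ G _ setT); last exact: filterT.
  move=> t _ i; exact: (Fin.case0 (fun i => A i t) i).
have GI := @filterI _ G FG _ _ (GA Fin.F1) (IH (fun i => A (Fin.FS i)) (fun i => GA _)).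
apply: (@filterS _ G FG _ _ _ GI) => t [h1 h2] i.
exact: (Fin.caseS' i (fun i => A i t)).
Qed.

Lemma fmap_ultra T U (f : T -> U) (G : set_system T) : UltraFilter G -> UltraFilter (f @ G).
Proof.
move=> UG; split; first exact: fmap_proper_filter.
move=> H PH GH; apply/seteqP; split=> // A HA.
have [//|nA] := in_ultra_setVsetC (f @^-1` A) UG.
have /(filterI HA) : H (~` A) by exact: GH.
by rewrite setICr => /filter_not_empty.
Qed.

(** An ultrafilter replaces the extraction of subsequences: all coordinates converge along it at
    once. *)
Lemma cluster_point n (x : nat -> Rn n) (M : R) : (forall k i, `|x k i| <= M) ->
  exists (G : set_system nat) (l : Rn n), [/\ ProperFilter G, \oo `<=` G &
    forall A, nbhs_Rn l A -> G [set k | A (x k)]].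
Proof.
move=> xM; have [G [UG subG]] := @ultraFilterLemma nat \oo _.
exists G.
have /choice[l Hl] (i : Fin.t n) : exists li : Rreal, x k i @[k --> G] --> li.
  have UfG : UltraFilter (x k i @[k --> G]) by exact: fmap_ultra.
  have := @segment_compact Rreal (- M) M; rewrite compact_ultra => /(_ _ UfG)[].
    by apply: (@filterS _ G _ setT) filterT => k _ /=; rewrite in_itv /= -ler_norml.
  by move=> li [_ cl]; exists li.
exists l; split; first exact: ultra_proper.
  by move=> A; exact: subG.
move=> A [d d0 Ad]; apply: filterS (_ : G [set k | forall i, `|x k i - l i| < d]).
  by move=> k H; apply: Ad.
apply: fin_filter => i.
have FG : Filter G by exact: filter_filter.
have H := (@cvgrPdist_lt Rreal Rreal nat G FG _ _).1 (Hl i) _ d0.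
by apply: (@filterS _ G FG _ _ _ H) => k; rewrite distrC.
Qed.

Section Coordinates.
Variable n : nat.

Definition fin_index (i : Fin.t n) : nat := proj1_sig (Fin.to_nat i).

Lemma fin_index_lt i : (fin_index i < n)%N.
Proof. by apply/ssrnat.ltP; exact: (proj2_sig (Fin.to_nat i)). Qed.

Lemma coord_ext (T : Type) (d : T) (x : Fin.t n -> T) : exists a : nat -> T, forall i, a (fin_index i) = x i.
Proof.
exists (fun k => if pselect (exists i, fin_index i = k) is left ex then x (projT1 (cid ex)) else d).
move=> i; case: pselect => [ex|[]]; last by exists i.
by case: (cid ex) => j /= /Fin.to_nat_inj->.
Qed.

Lemma fin_list : exists s : list (Fin.t n), forall i, List.In i s.
Proof.
elim: n => [|m [s Hs]]; first by exists nil => i; exact: (Fin.case0 (fun i => List.In i nil) i).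
exists (Fin.F1 :: List.map Fin.FS s)%list => i.
apply: (Fin.caseS' i (fun i => List.In i _)); first by left.
by move=> j; right; apply: List.in_map.
Qed.

Lemma norm_poly : exists N : Poly n, forall x i, x i ^+ 2 <= peval N x.
Proof.
have [s Hs] := fin_list.
exists (foldr PAdd (PConst 0) [seq PMul (PVar i) (PVar i) | i <- s]) => x i.
have pos t : 0 <= peval (foldr PAdd (PConst 0) [seq PMul (PVar i) (PVar i) | i <- t]) x.
  by elim: t => //= j t IH; rewrite RplusE RmultE addr_ge0 // -expr2 sqr_ge0.
elim: s {Hs} (Hs i) => //= j t IH [->|/IH le]; first by rewrite RplusE RmultE -expr2 lerDl pos.
by apply: le_trans le _; rewrite RplusE RmultE -expr2 lerDr sqr_ge0.
Qed.

End Coordinates.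

Section Lojasiewicz.
Variables (n : nat) (e : Rn n -> Rreal) (P Q U : Poly n) (x0 : Rn n).
Hypothesis econt : forall x, cont e x.
Arguments econt x : clear implicits.
Hypothesis Q0 : peval Q x0 != 0.
Hypothesis eQ : forall x, e x * peval Q x = peval P x.
Hypothesis U0 : forall x, (0 : R) <= peval U x.
Hypothesis Ue : forall x, peval U x = 0 -> e x = 0.

(** Compactness: otherwise points with [|e| >= s] and N <= 1 / s would have values of U tending to
    0, and U would vanish at a cluster point where e does not. *)
Lemma bounded_on_level (N : Poly n) (s : R) : (forall x i, x i ^+ 2 <= peval N x) -> 0 < s ->
  exists V : R, forall v x, s <= `|e x| -> s * peval N x <= 1 -> v * peval U x <= 1 -> v < V.
Proof.
move=> NP s0; apply: contrapT => H.
have /choice[x Hx] (k : nat) : exists x, [/\ s <= `|e x|, s * peval N x <= 1 & k%:R * peval U x <= 1].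
  apply: contrapT => Nx; apply: H; exists k%:R => v x h1 h2 h3; rewrite ltNge; apply/negP => kv.
  by apply: Nx; exists x; split => //; apply: le_trans h3; rewrite ler_wpM2r.
pose M := s^-1 + 1.
have sV : 0 < s^-1 by rewrite invr_gt0.
have [|G [l [PG ooG Gl]]] := @cluster_point n x M.
  move=> k i; have [_ h2 _] := Hx k.
  have : x k i ^+ 2 <= s^-1 by apply: le_trans (NP _ _) _; rewrite -[s^-1]mul1r -ler_pdivrMr ?invr_gt0 // invrK mulrC.
  rewrite ler_norml /M; nra.
have FG : Filter G by exact: filter_filter.
have near_imp (A : set (Rn n)) (B : set nat) : nbhs_Rn l A -> \oo B -> exists k, A (x k) /\ B k.
  move=> /Gl GA /ooG GB; have := @filterI _ G FG _ _ GA GB => GI.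
  by have [k [? ?]] := @filter_ex _ G PG _ GI; exists k.
have Ul : peval U l = 0.
  apply/eqP; apply: contrapT => /negP Ul0; have Upos : 0 < peval U l by rewrite lt_neqAle eq_sym Ul0 U0.
  have h : nbhs_Rn l [set y | peval U l / 2 < peval U y].
    have : 0 < peval U l - peval U l / 2 by lra.
    move=> /((cont_dist _ _).1 (cont_peval U l)); apply: filterS => y.
    by rewrite ltr_distlC => /andP[+ _]; rewrite /=; lra.
  have [k0 Hk0] : exists k0 : nat, 2 / peval U l < k0%:R.
    by exists (Num.bound (2 / peval U l)); exact: archi_boundP (divr_ge0 _ (U0 _)).
  have oo : \oo [set k | (k0 <= k)%N] by exact: nbhs_infty_ge.
  have [k [/= hk kk0]] := near_imp _ _ h oo.
  have [_ _ h3] := Hx k.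
  have : 2 / peval U l < k%:R by apply: lt_le_trans Hk0 _; rewrite ler_nat.
  rewrite ltr_pdivrMr // => h4.
  have k1 : 0 <= k%:R :> R by [].
  by nra.
have el : e l = 0 by exact: Ue.
have h : nbhs_Rn l [set y | `|e y| < s].
  have := (cont_dist _ _).1 (econt l) _ s0; apply: filterS => y.
  by rewrite el sub0r normrN.
have [k [/= hk _]] := near_imp _ _ h filterT.
by have [] := Hx k; rewrite leNgt hk.
Qed.

(** One parameter s both bounds e from below and confines x to a bounded set. Where Q is nonzero,
    the condition on e becomes polynomial, s^2 Q^2 <= P^2. *)
Lemma lojasiewicz_level (N : Poly n) : (forall x i, x i ^+ 2 <= peval N x) ->
  exists m s0, 0 < s0 :> R /\ forall x s, 0 < s < s0 -> peval Q x != 0 -> s <= `|e x| ->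
    s * peval N x <= 1 -> s ^+ m < peval U x.
Proof.
move=> NP.
(* The inner variable is s and the outer one is v. *)
pose B : idomainType := {poly {poly Rreal}}.
pose cst (c : R) : iter_poly B n := icst B n ((c%:P : {poly Rreal})%:P).
pose T (p : Poly n) := poly_map_eval cst (fun i => ivar B n (fin_index i)) p.
pose S : iter_poly B n := icst B n (('X : {poly Rreal})%:P).
pose V : iter_poly B n := icst B n 'X.
pose evB (s v : Rreal) : {rmorphism B -> Rreal} := (horner_eval s) \o (horner_eval (v%:P : {poly Rreal})).
have evT s v a p : ieval (evB s v) a n (T p) = peval p (fun i => a (fin_index i)).
  rewrite pevalE; apply: poly_map_eval_morph => [c _|i]; last by rewrite ieval_var ?fin_index_lt.
  by rewrite ieval_cst /= /horner_eval !hornerE.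
have evS s v a : ieval (evB s v) a n S = s.
  by rewrite ieval_cst /= /horner_eval !hornerE.
have evV s v a : ieval (evB s v) a n V = v.
  by rewrite ieval_cst /= /horner_eval !hornerE.
(* By sign determination, whether v satisfies [M s v] depends only on the signs of finitely
   many polynomials in (s, v), which are constant for small s and v >= s^-m; as the set of
   such v is bounded, it lies below s^-m. *)
pose M s v := exists x, [/\ peval Q x != 0, s ^+ 2 * peval Q x ^+ 2 <= peval P x ^+ 2,
  s * peval N x <= 1 & v * peval U x <= 1].
have [L HL] := @sign_transfer B n [:: T Q; T P ^+ 2 - S ^+ 2 * T Q ^+ 2; 1 - S * T N; 1 - V * T U].
have transfer s v s' v' : (forall b, b \in L -> samesign (evB s v b, evB s' v' b)) -> M s v -> M s' v'.
  move=> sgn [x [h1 h2 h3 h4]]; have [a ax] := coord_ext (0 : R) x.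
  have [|a' Ha'] := HL Rreal Rreal (ieval (evB s v) a n) (evB s' v').
    by move=> b bL; rewrite /samesign /= ieval_cst; exact: sgn.
  have ax' : (fun i => a (fin_index i)) = x by apply: funext.
  exists (fun i => a' (fin_index i)); split.
  - have := Ha' (T Q); rewrite inE eqxx => /(_ isT) /samesign_eq0 /=.
    by rewrite !evT ax' => <-.
  - have := Ha' (T P ^+ 2 - S ^+ 2 * T Q ^+ 2); rewrite !inE eqxx orbT => /(_ isT) /samesign_lt0 /=.
    rewrite !rmorphB !(rmorphM _ (S ^+ 2)) /= !rmorphXn /= !evT !evS ax' -[LHS]negbK -leNgt subr_ge0 h2 /=.
    by move=> /esym/negbT; rewrite -leNgt subr_ge0.
  - have := Ha' (1 - S * T N); rewrite !inE eqxx !orbT => /(_ isT) /samesign_lt0 /=.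
    rewrite !rmorphB !rmorphM /= !rmorph1 !evT !evS ax' -[LHS]negbK -leNgt subr_ge0 h3 /=.
    by move=> /esym/negbT; rewrite -leNgt subr_ge0.
  - have := Ha' (1 - V * T U); rewrite !inE eqxx !orbT => /(_ isT) /samesign_lt0 /=.
    rewrite !rmorphB !rmorphM /= !rmorph1 !evT !evV ax' -[LHS]negbK -leNgt subr_ge0 h4 /=.
    by move=> /esym/negbT; rewrite -leNgt subr_ge0.
have [m [s0 [s00 s01 Hm]]] := germ_signs L.
exists m, s0; split => // x s /andP[sgt slt] Qx se sN; rewrite ltNge; apply/negP => Us.
have [W HW] := bounded_on_level NP sgt.
pose v := (s ^+ m)^-1; have sm : 0 < s ^+ m by rewrite exprn_gt0.
have v0 : 0 < v by rewrite invr_gt0.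
pose v' := Num.max v W.
have : M s v.
  exists x; split => //; last by rewrite ler_pdivrMl // mulr1.
  rewrite -eQ !exprMn ler_pM2r ?exprn_even_gt0 //=.
  by rewrite -[e x ^+ 2]real_normK ?num_real // lerXn2r // ?nnegrE // ltW.
move=> /(@transfer s v s v')[].
  move=> b /Hm[sigma Hs]; rewrite /samesign /= /horner_eval !Hs ?sgt //.
  - by rewrite lt_max v0.
  - by rewrite mulrC -ler_pdivrMl // mulr1 le_max lexx.
  - by rewrite mulVf // lt0r_neq0.
move=> y [Qy h2 h3 h4].
have : v' < W.
  apply: (HW v' y) => //; move: h2; rewrite -eQ !exprMn ler_pM2r ?exprn_even_gt0 //=.
  by rewrite -[e y ^+ 2]real_normK ?num_real // ler_pXn2r // ?nnegrE // ltW.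
by rewrite ltNge le_max lexx orbT.
Qed.

(** A counterexample x satisfies only strict inequalities, so it can be moved to a nearby y with Q
    nonzero; there the level estimate applies with s the absolute value of e at y. *)
Theorem lojasiewicz : exists m s0 (N : Poly n), 0 < s0 :> R /\ forall x, 0 < `|e x| < s0 ->
  `|e x| * peval N x < 1 -> `|e x| ^+ m <= peval U x.
Proof.
have [N NP] := norm_poly n; have [m [s0 [s00 H]]] := lojasiewicz_level NP.
exists m, s0, N; split => // x /andP[e0 es] eN; rewrite leNgt; apply/negP => Ux.
pose d (y : Rn n) : Rreal := `|e y|.
have dc y : cont d y by apply: cvg_norm; exact: econt.
have dXc k y : cont (fun y => d y ^+ k) y.
  by elim: k => [|k IH]; [exact: cont_cst|under eq_fun do rewrite exprS; exact: contM].
have n1 : \forall y \near nbhs_Rn x, 0 < d y by exact: cont_gt0.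
have n2 : \forall y \near nbhs_Rn x, 0 < s0 - d y.
  by apply: cont_gt0; [exact: contD (cont_cst s0 x) (contN (dc x))|rewrite subr_gt0].
have n3 : \forall y \near nbhs_Rn x, 0 < 1 - d y * peval N y.
  apply: cont_gt0; last by rewrite subr_gt0.
  exact: contD (cont_cst 1 x) (contN (contM (dc x) (cont_peval N x))).
have n4 : \forall y \near nbhs_Rn x, 0 < d y ^+ m - peval U y.
  by apply: cont_gt0; [exact: contD (dXc m x) (contN (cont_peval U x))|rewrite subr_gt0].
have [y [[h1 h2] [h3 h4]] Qy] := dense_nonzero Q0 (filterI (filterI n1 n2) (filterI n3 n4)).
move: h2 h3 h4; rewrite /= !subr_gt0 => h2 h3 h4.
have := H y (d y); rewrite h1 h2 => /(_ isT Qy (lexx _) (ltW h3)).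
by rewrite ltNge (ltW h4).
Qed.

End Lojasiewicz.

(** * Sums of squares *)

Lemma sum_sq_cons n (g : Rn n -> R) gs x : sum_sq (g :: gs) x = g x ^+ 2 + sum_sq gs x.
Proof. by rewrite -RpowE. Qed.

Section Good.
Variables (n : nat) (f : Rn n -> Rreal) (p q : Poly n) (x0 x1 : Rn n).
Hypothesis fcont : forall x, cont f x.
Arguments fcont x : clear implicits.
Hypothesis q0 : peval q x0 != 0.
Hypothesis fE : forall x, peval q x != 0 -> f x * peval q x = peval p x.
Hypothesis f0 : forall x, 0 <= f x.
Hypothesis fx1 : 0 < f x1.
Implicit Types (g h : Rn n -> Rreal) (P Q : Poly n).

(** The functions regulous on {f > 0}; their values elsewhere are unconstrained. It is enough that Q
    be nonzero somewhere, since its nonzeros are then dense. *)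
Definition good h := (forall x, 0 < f x -> cont h x) /\
  exists P Q, (exists y, peval Q y != 0) /\ forall x, 0 < f x -> peval Q x != 0 -> h x * peval Q x = peval P x.

Lemma nonzeroM P Q : (exists y, peval P y != 0) -> (exists y, peval Q y != 0) ->
  exists y, peval (PMul P Q) y != 0.
Proof.
move=> [y Py] [y' Qy'].
have [z Pz Qz] := dense_nonzero Qy' (cont_neq0 (cont_peval P y) Py).
by exists z => /=; rewrite RmultE mulf_neq0.
Qed.

Lemma good_poly P : good (peval P).
Proof.
split=> [x _|]; first exact: cont_peval.
exists P, (PConst 1); split; first by exists (fun=> 0); rewrite /= oner_eq0.
by move=> x _ _ /=; rewrite mulr1.
Qed.

Lemma good_cst (c : Rreal) : good (fun=> c).
Proof. exact: (good_poly (PConst c)). Qed.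

Lemma goodD g h : good g -> good h -> good (fun x => g x + h x).
Proof.
move=> [cg [P [Q [nQ EQ]]]] [ch [P' [Q' [nQ' EQ']]]]; split=> [x Wx|].
  by apply: contD; [exact: cg|exact: ch].
exists (PAdd (PMul P Q') (PMul P' Q)), (PMul Q Q'); split; first exact: nonzeroM.
move=> x Wx /=; rewrite !RplusE !RmultE mulf_eq0 negb_or => /andP[Qx Q'x].
by rewrite -EQ // -EQ' //; ring.
Qed.

Lemma goodM g h : good g -> good h -> good (fun x => g x * h x).
Proof.
move=> [cg [P [Q [nQ EQ]]]] [ch [P' [Q' [nQ' EQ']]]]; split=> [x Wx|].
  by apply: contM; [exact: cg|exact: ch].
exists (PMul P P'), (PMul Q Q'); split; first exact: nonzeroM.
move=> x Wx /=; rewrite !RmultE mulf_eq0 negb_or => /andP[Qx Q'x].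
by rewrite -EQ // -EQ' //; ring.
Qed.

Lemma goodX g k : good g -> good (fun x => g x ^+ k).
Proof.
move=> Gg; elim: k => [|k IH]; first exact: good_cst.
by under eq_fun do rewrite exprS; exact: goodM.
Qed.

Lemma good_f : good f.
Proof. by split=> [x _|]; [exact: fcont|exists p, q; split; [exists x0|move=> x _; exact: fE]]. Qed.

Lemma goodV g : good g -> (forall x, 0 < f x -> g x != 0) -> good (fun x => (g x)^-1).
Proof.
move=> [cg [P [Q [[y Qy] EQ]]]] g0; split=> [x Wx|].
  by apply: contV; [exact: g0|exact: cg].
(* The common factor Q confines the claim to points where g Q = P is known. *)
exists (PMul Q Q), (PMul P Q); split.
  have [z Wz Qz] := dense_nonzero Qy (cont_gt0 (fcont x1) fx1).
  by exists z; rewrite /= RmultE mulf_neq0 // -EQ // mulf_neq0 // g0.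
move=> x Wx /=; rewrite !RmultE mulf_eq0 negb_or => /andP[_ Qx].
by rewrite -EQ // mulrA mulKf ?g0.
Qed.

Lemma good_ieval (B : idomainType) (fB : Rn n -> {rmorphism B -> Rreal}) (a : Rn n -> nat -> Rreal) k :
  (forall b, good (fun x => fB x b)) -> (forall i, (i < k)%N -> good (fun x => a x i)) ->
  forall b : iter_poly B k, good (fun x => ieval (fB x) (a x) k b).
Proof.
move=> GB; elim: k => [|k IH] //= Ga; elim/poly_ind => [|b c IHb].
  by rewrite (_ : (fun x => _) = (fun=> 0)); [exact: good_cst|apply: funext => x; rewrite rmorph0 /horner_eval horner0].
rewrite (_ : (fun x => _) = (fun x => (map_poly (ieval (fB x) (a x) k) b).[a x k] * a x k + ieval (fB x) (a x) k c)).
  apply: goodD; last by apply: IH => i ik; apply: Ga; exact: leqW.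
  by apply: goodM => //; exact: Ga.
by apply: funext => x; rewrite /horner_eval rmorphD rmorphM /= map_polyX map_polyC hornerMXaddC.
Qed.

(** One power beyond the Lojasiewicz exponent makes e^(m+1) / U at most e in absolute value near the
    zeros of U, so the quotient extends continuously by 0. *)
Lemma lojasiewicz_quotient (e : Rn n -> Rreal) (P Q U : Poly n) y0 : (forall x, cont e x) ->
  peval Q y0 != 0 -> (forall x, e x * peval Q x = peval P x) ->
  (forall x, (0 : R) <= peval U x) -> (forall x, peval U x = 0 -> e x = 0) ->
  exists m g, good g /\ forall x, e x ^+ m.+1 = peval U x * g x.
Proof.
move=> ce Qy eQ U0 Ue.
have [m [s0 [N [s00 H]]]] := lojasiewicz (fun x => ce x) Qy eQ U0 Ue.
pose g x : Rreal := if peval U x == 0 then 0 else e x ^+ m.+1 / peval U x.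
have gU x : e x ^+ m.+1 = peval U x * g x.
  rewrite /g; have [Ux|Ux] := eqVneq (peval U x) 0; last by rewrite mulrC divfK.
  by rewrite Ue // expr0n mulr0.
exists m, g; split => //.
have Ge : good e by split=> [x _|]; [exact: ce|exists P, Q; split; [exists y0|]].
have cX k x : cont (fun y => e y ^+ k) x.
  by elim: k => [|k IH]; [exact: cont_cst|under eq_fun do rewrite exprS; exact: contM (ce x) IH].
split=> [x _|]; last first.
  have [[y Uy]|nU] := pselect (exists y, peval U y != 0).
    have [_ [P' [Q' [nQ' EQ']]]] := goodX m.+1 Ge.
    exists P', (PMul U Q'); split; first by apply: nonzeroM => //; exists y.
    move=> x Wx /=; rewrite RmultE mulf_eq0 negb_or => /andP[Ux Q'x].
    by rewrite mulrA [g x * _]mulrC -gU EQ'.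
  have -> : g = fun=> 0.
    by apply: funext => x; rewrite /g; case: eqVneq => // Ux; case: nU; exists x.
  by have [] := good_cst 0.
have [Ux|Ux] := eqVneq (peval U x) 0; last first.
  have c1 : cont (fun y => e y ^+ m.+1 * (peval U y)^-1) x.
    by apply: contM; [exact: cX|apply: contV => //; exact: cont_peval].
  apply: (cont_near _ c1); last by rewrite /g (negPf Ux).
  apply: filterS (cont_neq0 (cont_peval U x) Ux) => y Uy.
  by rewrite /g (negPf Uy).
have ex0 := Ue _ Ux; have gx : g x = 0 by rewrite /g Ux eqxx.
apply/cont_dist => eps eps0; rewrite gx.
have n1 := (cont_dist _ _).1 (ce x) _ s00; have n2 := (cont_dist _ _).1 (ce x) _ eps0.
(* e^2 N^2 is continuous and vanishes at x, which secures the growth condition of [lojasiewicz]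
   nearby. *)
have n3 := (cont_dist _ _).1 (contM (contM (ce x) (ce x)) (contM (cont_peval N x) (cont_peval N x))) _ ltr01.
apply: filterS (filterI (filterI n1 n2) n3) => y [[/=]].
rewrite ex0 !mul0r !sub0r !normrN => h1 h2 h3.
apply: le_lt_trans h2; rewrite /g; case: eqVneq => [_|Uy]; first by rewrite normr0.
have [->|ey] := eqVneq (e y) 0; first by rewrite expr0n mul0r normr0.
have Upos : 0 < peval U y by rewrite lt_neqAle eq_sym Uy U0.
rewrite normrM normfV (gtr0_norm Upos) ler_pdivrMr // exprS normrM ler_pM2l ?normr_gt0 // normrX.
apply: H; first by rewrite normr_gt0 ey.
have : (`|e y| * peval N y) ^+ 2 < 1.
  by apply: le_lt_trans h3; rewrite normrM !normrM -!expr2 exprMn real_normK ?num_real // real_normK ?num_real.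
by move: (`|e y| * _) => t; nra.
Qed.

Inductive sos : (Rn n -> Rreal) -> Prop :=
| sos0 : sos (fun=> 0)
| sos_add g s : good g -> sos s -> sos (fun x => g x ^+ 2 + s x).

Lemma sosD s t : sos s -> sos t -> sos (fun x => s x + t x).
Proof.
move=> Ss St; elim: Ss => [|g s' Gg _ IH].
  by under eq_fun do rewrite add0r.
by under eq_fun do rewrite -addrA; exact: sos_add.
Qed.

Lemma sosM s t : sos s -> sos t -> sos (fun x => s x * t x).
Proof.
move=> Ss St; elim: Ss => [|g s' Gg _ IH].
  by under eq_fun do rewrite mul0r; exact: sos0.
under eq_fun do rewrite mulrDl; apply: sosD => //.
elim: St => [|h t' Gh _ IH']; first by under eq_fun do rewrite mulr0; exact: sos0.
by under eq_fun do rewrite mulrDr -exprMn; apply: sos_add => //; exact: goodM.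
Qed.

Lemma sos_sqr g : good g -> sos (fun x => g x ^+ 2).
Proof. by move=> Gg; have := sos_add Gg sos0; under eq_fun do rewrite addr0. Qed.

Lemma sos_good s : sos s -> good s.
Proof.
elim=> [|g s' Gg _ IH]; first exact: good_cst.
by apply: goodD => //; exact: goodX.
Qed.

Lemma sos_ge0 s x : sos s -> 0 <= s x.
Proof. by elim=> // g s' _ _ IH; rewrite addr_ge0 // sqr_ge0. Qed.

Lemma sos_list s : sos s -> exists gs, List.Forall good gs /\ forall x, s x = sum_sq gs x.
Proof.
elim=> [|g s' Gg _ [gs [Ggs E]]]; first by exists nil.
exists (g :: gs); split; first by constructor.
by move=> x; rewrite sum_sq_cons E.
Qed.

Lemma regulous_of_certificate s t : sos s -> sos t ->
  (forall x, 0 < f x -> -1 = s x - f x * t x) ->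
  exists gs : list (Rn n -> R), List.Forall (fun g => regulous g) gs /\ forall x, f x = sum_sq gs x.
Proof.
move=> Ss St E.
have ft x : 0 < f x -> f x * t x = 1 + s x by move=> /E; move: (f x * t x) (s x) => u v; lra.
have t0 x : 0 < f x -> t x != 0.
  move=> Wx; have := ft x Wx; apply: contra_eq_neq => ->; rewrite mulr0.
  by rewrite lt_eqF // ltr_pwDl // sos_ge0.
have Gt := sos_good St; have GtV := goodV Gt t0.
have Sb : sos (fun x => (1 + s x) * t x * (t x)^-1 ^+ 2).
  apply: sosM; last exact: sos_sqr.
  apply: sosM => //; apply: sosD => //.
  by have := sos_sqr (good_cst 1); under eq_fun do rewrite expr1n.
have [hs [Ghs Ehs]] := sos_list Sb.
pose cut h x : R := if 0 < f x then h x else 0.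
exists (List.map cut hs); split; last first.
  move=> x; have [Wx|nWx] := boolP (0 < f x).
    have -> : sum_sq (List.map cut hs) x = sum_sq hs x.
      by elim: (hs) => // h hs' IH; rewrite [List.map _ _]/= !sum_sq_cons IH /cut Wx.
    by rewrite -Ehs -ft // expr2 mulrA mulfK ?t0 // -mulrA mulfV ?t0 // mulr1.
  have -> : f x = 0 by apply: le_anti; rewrite f0 leNgt nWx.
  by elim: (hs) => // h hs' IH; rewrite [List.map _ _]/= sum_sq_cons -IH /cut (negPf nWx) expr0n addr0.
have bound h x : List.In h hs -> 0 < f x -> h x ^+ 2 <= f x.
  move=> hin Wx; have -> : f x = sum_sq hs x.
    by rewrite -Ehs -ft // expr2 mulrA mulfK ?t0 // -mulrA mulfV ?t0 // mulr1.
  have pos gs : (0 : R) <= sum_sq gs x.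
    by elim: gs => // g gs IH; rewrite sum_sq_cons addr_ge0 // sqr_ge0.
  elim: (hs) hin => // g gs IH [->|/IH le]; rewrite sum_sq_cons; first by rewrite lerDl pos.
  by apply: le_trans le _; rewrite lerDr sqr_ge0.
apply/List.Forall_map/List.Forall_forall => h hin.
have [ch [P [Q [nQ EQ]]]] : good h by move/List.Forall_forall: Ghs; apply.
split.
  apply/contP => x; have [Wx|nWx] := boolP (0 < f x).
    apply: (cont_near _ (ch x Wx)); last by rewrite /cut Wx.
    by apply: filterS (cont_gt0 (fcont x) Wx) => y Wy; rewrite /cut Wy.
  have fx0 : f x = 0 by apply: le_anti; rewrite f0 leNgt nWx.
  apply/cont_dist => eps eps0; rewrite [cut h x]/cut (negPf nWx).
  have := (cont_dist _ _).1 (fcont x) _ (exprn_gt0 2 eps0).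
  apply: filterS => y; rewrite fx0 !sub0r !normrN (ger0_norm (f0 y)) => fy.
  rewrite /cut; case: ifP => Wy; last by rewrite normr0.
  have : `|h y| ^+ 2 < eps ^+ 2 by rewrite real_normK ?num_real // (le_lt_trans (bound _ _ hin Wy)).
  by rewrite ltr_pXn2r // ?nnegrE // ltW.
have nq : exists y, peval q y != 0 by exists x0.
have np : exists y, peval p y != 0.
  have [z Wz qz] := dense_nonzero q0 (cont_gt0 (fcont x1) fx1).
  by exists z; rewrite -fE // mulf_neq0 // lt0r_neq0.
(* Where p and q are both nonzero, so is f. This open set therefore lies in {f > 0}, where [cut]
   changes nothing. *)
exists [:: PMul Q (PMul p q)], P, Q; split.
  have [y Hy] := nonzeroM nQ (nonzeroM np nq); exists y => H.
  by move/eqP: Hy; apply; apply: H; left.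
move=> x Zx; have : peval (PMul Q (PMul p q)) x != 0.
  by apply: contra_notN Zx => /eqP H g [<-|[]].
rewrite /= !RmultE !mulf_eq0 !negb_or => /and3P[Qx px qx].
have Wx : 0 < f x.
  rewrite lt_neqAle f0 andbT; apply: contraNneq px => fx.
  by rewrite -fE // -fx mul0r.
split; first exact/eqP.
by rewrite RdivE -EQ // mulfK // /cut Wx.
Qed.

End Good.

(** * Existence of the certificate *)

Section Certificate.
Variables (n : nat) (f : Rn n -> Rreal) (p q : Poly n) (x0 x1 : Rn n).
Hypothesis fcont : forall x, cont f x.
Arguments fcont x : clear implicits.
Hypothesis q0 : peval q x0 != 0.
Hypothesis fE : forall x, peval q x != 0 -> f x * peval q x = peval p x.
Hypothesis f0 : forall x, 0 <= f x.
Hypothesis fx1 : 0 < f x1.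

Let qj j := lcoef x0 q j.
Let pj j := lcoef x0 p j.
Let D := pdeg q.

(** By [strata], f q_j - p_j vanishes wherever all q_i with i < j do; it is rational with
    denominator q and numerator p q_j - q p_j. *)
Lemma strata_quotient j : exists m g, good f g /\ forall x,
  (f x * peval (qj j) x - peval (pj j) x) ^+ m.+1 = (\sum_(i < j) peval (qj i) x ^+ 2) * g x.
Proof.
pose U : Poly n := foldr PAdd (PConst 0) [seq PMul (qj i) (qj i) | i <- iota 0 j].
have UE x : peval U x = \sum_(i < j) peval (qj i) x ^+ 2.
  rewrite -(big_mkord xpredT (fun i => peval (qj i) x ^+ 2)) /index_iota subn0 /U.
  elim: (iota 0 j) => [|i s IH]; first by rewrite big_nil.
  by rewrite big_cons /= IH.
have U0 x : (0 : R) <= peval U x by rewrite UE sumr_ge0 // => i _; rewrite sqr_ge0.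
have Ue x : peval U x = 0 -> f x * peval (qj j) x - peval (pj j) x = 0.
  rewrite UE => /eqP; rewrite psumr_eq0; last by move=> i _; rewrite sqr_ge0.
  move=> /allP H; apply/eqP; rewrite subr_eq0; apply/eqP; apply: (strata fcont q0 fE) => i ij.
  by apply/eqP; have := H (Ordinal ij) (mem_index_enum _); rewrite /= sqrf_eq0.
have ce x : cont (fun x => f x * peval (qj j) x - peval (pj j) x) x.
  exact: contD (contM (fcont x) (cont_peval _ x)) (contN (cont_peval _ x)).
have [|m [g [Gg E]]] := @lojasiewicz_quotient n f _ (PAdd (PMul p (qj j)) (PMul (PConst (-1)) (PMul q (pj j)))) q U x0 ce q0 _ U0 Ue.
  by move=> x; rewrite /= !RplusE !RmultE -(f_mul_q fcont q0 fE) mulrBl mulN1r mulrAC [in X in _ - X]mulrC.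
by exists m, g; split => // x; rewrite E UE.
Qed.

(** Only finitely many functions matter in K, so the function ring is replaced by a polynomial ring
    A with a variable for each of them, evaluated at real points by [ev]. *)
Lemma certificate : exists s t, [/\ sos f s, sos f t & forall x, 0 < f x -> -1 = s x - f x * t x].
Proof.
have /choice[m /choice[g Hg]] := strata_quotient.
have Gg j : good f (g j) := (Hg j).1; have gE j := (Hg j).2.
(* The polynomial ring [A] must be countable, so its coefficients are integers and the real constants of the
   polynomials involved are among its variables. *)
pose cs := flatten [seq consts (qj j) ++ consts (pj j) | j <- iota 0 D].
pose B0 := iter_poly (int : idomainType) (size cs).
pose Lam := iter_poly B0 n.
pose A := iter_poly Lam D.+2.
pose hat (P : Poly n) : Lam := poly_map_eval (fun c => icst B0 n (ivar (int : idomainType) (size cs) (index c cs)))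
  (fun i => ivar B0 n (fin_index i)) P.
pose evc : {rmorphism B0 -> Rreal} := ieval (intmul 1 : {rmorphism int -> Rreal}) (nth 0 cs) (size cs).
have /choice[coord Hcoord] := fun x : Rn n => coord_ext (0 : Rreal) x.
pose evl x : {rmorphism Lam -> Rreal} := ieval evc (coord x) n.
(* The outer D + 2 variables stand for g_0, ..., g_(D-1), f and 1/f, in this order. *)
pose extra x k : Rreal := if (k < D)%N then g k x else if k == D then f x else (f x)^-1.
pose ev x : {rmorphism A -> Rreal} := ieval (evl x) (extra x) D.+2.
pose inc : {rmorphism Lam -> A} := icst Lam D.+2.
have evl_hat a P : {subset consts P <= cs} -> ieval evc a n (hat P) = peval P (fun i => a (fin_index i)).
  move=> sub; rewrite pevalE; apply: poly_map_eval_morph => [c /sub cin|i].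
    by rewrite ieval_cst /evc ieval_var ?index_mem // nth_index.
  by rewrite ieval_var // fin_index_lt.
have ev_hat x P : {subset consts P <= cs} -> ev x (inc (hat P)) = peval P x.
  move=> sub; rewrite /ev /inc ieval_cst /evl evl_hat //.
  by congr (peval P _); apply: funext => i; exact: Hcoord.
have subq j : (j < D)%N -> {subset consts (qj j) <= cs}.
  move=> jD c cin; apply/flatten_mapP; exists j; first by rewrite mem_iota.
  by rewrite mem_cat cin.
have subp j : (j < D)%N -> {subset consts (pj j) <= cs}.
  move=> jD c cin; apply/flatten_mapP; exists j; first by rewrite mem_iota.
  by rewrite mem_cat cin orbT.
have Gev (a : A) : good f (fun x => ev x a).
  apply: good_ieval => [b|i iD].
    apply: good_ieval => [c|i i_n]; first exact: good_cst.
    have -> : (fun x => coord x i) = peval (PVar (Fin.of_nat_lt (ssrnat.ltP i_n))).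
      apply: funext => x /=; rewrite -Hcoord /fin_index; congr (coord x _).
      by rewrite Fin.to_nat_of_nat.
    exact: good_poly.
  rewrite /extra; case: (i < D)%N; first exact: Gg.
  case: (i == D); first exact: (good_f fcont q0 fE).
  by apply: (goodV fcont fx1) => [|x Wx]; [exact: (good_f fcont q0 fE)|rewrite lt0r_neq0].
(* The preorder of the functions s - f t, pulled back to A; if it contained -1, that would be the
   certificate. *)
pose T (a : A) := exists s t, [/\ sos f s, sos f t & forall x, 0 < f x -> ev x a = s x - f x * t x].
have sosf2 : sos f (fun x => f x ^+ 2) by apply: sos_sqr; exact: (good_f fcont q0 fE).
have sosT s a : sos f s -> (forall x, 0 < f x -> ev x a = s x) -> T a.
  by move=> Ss E; exists s, (fun=> 0); split=> // [|x Wx]; [exact: sos0|rewrite E // mulr0 subr0].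
apply: contrapT => NC.
have preT : precone T.
  split.
  - move=> a b [s [t [Ss St E]]] [s' [t' [Ss' St' E']]].
    exists (fun x => s x + s' x), (fun x => t x + t' x); split; try exact: sosD.
    by move=> x Wx; rewrite rmorphD E // E' //; ring.
  - move=> a b [s [t [Ss St E]]] [s' [t' [Ss' St' E']]].
    exists (fun x => s x * s' x + f x ^+ 2 * (t x * t' x)), (fun x => s x * t' x + t x * s' x); split.
    + by apply: sosD; [exact: sosM|apply: sosM => //; exact: sosM].
    + by apply: sosD; exact: sosM.
    + by move=> x Wx; rewrite rmorphM E // E' //; ring.
  - move=> a; apply: (sosT (fun x => ev x a ^+ 2)); first exact: sos_sqr.
    by move=> x _; rewrite rmorphM.
  - move=> [s [t [Ss St E]]]; apply: NC; exists s, t; split => // x Wx.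
    by rewrite -E // rmorphN1.
have [e inje] : exists e : A -> nat, injective e.
  have [e0 ie0] := @iter_poly_countable (int : idomainType) pickle (size cs) (pcan_inj pickleK).
  have [e1 ie1] := iter_poly_countable n ie0.
  exact: iter_poly_countable ie1.
have [K [phi phiT]] := real_closed_extension inje preT.
have sos_cst c : 0 <= c -> sos f (fun=> c).
  move=> c0; have := sos_sqr (good_cst f (Num.sqrt c)).
  by under eq_fun do rewrite sqr_sqrtr //.
(* For an integer k > 1/c the constant k c - 1 is a square, so k a - 1 lies in T and phi a is
   positive. *)
have phi_pos a c : 0 < c -> (forall x, 0 < f x -> ev x a = c) -> 0 < phi a.
  move=> c0 E.
  have [k ck] : exists k : nat, c^-1 < k%:R.
    by exists (Num.bound c^-1); apply: archi_boundP; rewrite invr_ge0 ltW.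
  have : T (a *+ k - 1).
    apply: (sosT (fun=> c *+ k - 1)).
      apply: sos_cst; rewrite subr_ge0 -mulr_natr -ler_pdivrMl // mulr1; exact: ltW.
    by move=> x Wx; rewrite rmorphB rmorphMn rmorph1 E.
  move=> /phiT; rewrite rmorphB rmorphMn rmorph1 subr_ge0 => k1.
  by have := lt_le_trans ltr01 k1; rewrite pmulrn_lgt0 //; case: k {k1} ck => // /lt_gtF; rewrite invr_gt0 c0.
have phi_cst a c : (forall x, 0 < f x -> ev x a = c) -> samesign (phi a, c).
  move=> E; rewrite /samesign /=; have [c0|c0|c0] := ltgtP c 0.
  - have : 0 < phi (- a) by apply: (phi_pos _ (- c)); rewrite ?oppr_gt0 // => x Wx; rewrite rmorphN E.
    by rewrite rmorphN oppr_gt0 => pa; rewrite !ltr0_sgz.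
  - by rewrite !gtr0_sgz //; exact: phi_pos c0 E.
  - have h1 : 0 <= phi a by apply: phiT; apply: (sosT (fun=> 0)); [exact: sos0|move=> x /E->].
    have h2 : 0 <= phi (- a).
      by apply: phiT; apply: (sosT (fun=> 0)); [exact: sos0|move=> x Wx; rewrite rmorphN E // c0 oppr0].
    by rewrite (_ : phi a = 0) ?c0 ?sgz0 //; apply: le_anti; rewrite h1 -oppr_ge0 -rmorphN h2.
have phi0 a : (forall x, 0 < f x -> ev x a = 0) -> phi a = 0.
  by move=> /phi_cst /samesign_eq0 /=; rewrite eqxx => /eqP.
pose var k : A := ivar Lam D.+2 k.
have ev_var x k : (k < D.+2)%N -> ev x (var k) = extra x k by move=> kD; rewrite /ev ieval_var.
have evF x : ev x (var D) = f x by rewrite ev_var // /extra ltnn eqxx.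
have evFi x : ev x (var D.+1) = (f x)^-1.
  by rewrite ev_var // /extra ltnNge leqnSn /= gtn_eqF.
have evG x j : (j < D)%N -> ev x (var j) = g j x.
  by move=> jD; rewrite ev_var /extra ?jD // ltnW // ltnS ltnW.
(* -f lies in T, and the variable for 1/f makes the image of f invertible. *)
have phiF : phi (var D) < 0.
  have : phi (var D) * phi (var D.+1) = 1.
    apply/eqP; rewrite -subr_eq0 -rmorphM -(rmorph1 phi) -rmorphB; apply/eqP; apply: phi0 => x Wx.
    by rewrite rmorphB rmorphM rmorph1 evF evFi mulfV ?subrr // lt0r_neq0.
  move=> FF; rewrite lt_neqAle; apply/andP; split.
    by apply/eqP => F0; move/eqP: FF; rewrite F0 mul0r eq_sym oner_eq0.
  rewrite -oppr_ge0 -rmorphN; apply: phiT; exists (fun=> 0), (fun=> 1); split.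
  - exact: sos0.
  - exact: sos_cst.
  - by move=> x _; rewrite rmorphN evF mulr1 sub0r.
pose Q j := phi (inc (hat (qj j))); pose P j := phi (inc (hat (pj j))).
have [j jD [Qlow Qj]] : exists2 j, (j < D)%N & (forall i, (i < j)%N -> Q i = 0) /\ Q j != 0.
  have exj : exists j, (j < D)%N && (Q j != 0).
    apply: contrapT => H.
    have Qz (i : 'I_D) : Q i = 0.
      by apply/eqP; apply: contrapT => /negP Qi; apply: H; exists i; rewrite ltn_ord.
    have : samesign (phi (\sum_(i < D) inc (hat (qj i))), peval q x0).
      apply: phi_cst => x _; rewrite rmorph_sum -(sum_lcoef x0 q x).
      by apply: eq_bigr => i _; apply: ev_hat; exact: subq.
    move=> /samesign_eq0 /=; rewrite (negPf q0) rmorph_sum big1 ?eqxx // => i _; exact: Qz.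
  case: (ex_minnP exj) => j /andP[jD Qj] minj; exists j => //; split => // i ij.
  apply/eqP; apply: contrapT => /negP Qi; have := minj i; rewrite Qi (ltn_trans ij jD) => /(_ isT).
  by rewrite leqNgt ij.
have PQ : P j = phi (var D) * Q j.
  (* In K the q_i with i < j vanish, so the divisibility identity makes a power of E zero. *)
  pose E := var D * inc (hat (qj j)) - inc (hat (pj j)).
  have : phi (E ^+ (m j).+1 - (\sum_(i < j) inc (hat (qj i)) ^+ 2) * var j) = 0.
    apply: phi0 => x Wx; apply/eqP.
    rewrite rmorphB rmorphXn rmorphM rmorphB rmorphM rmorph_sum evF evG // !ev_hat; [|exact: subp|exact: subq].
    rewrite subr_eq0 gE; apply/eqP; congr (_ * _); apply: eq_bigr => i _.
    by rewrite rmorphXn ev_hat //; apply: subq; exact: ltn_trans (ltn_ord i) jD.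
  rewrite rmorphB rmorphM rmorph_sum big1; last first.
    by move=> i _; rewrite rmorphXn /= [phi _]Qlow // expr0n.
  rewrite mul0r subr0 rmorphXn => /eqP; rewrite expf_eq0 /= rmorphB rmorphM subr_eq0 => /eqP H.
  exact: esym H.
have PQneg : P j * Q j < 0.
  by rewrite PQ -mulrA nmulr_rlt0 // -expr2 exprn_even_gt0.
have [L HL] := @sign_transfer B0 n ([seq hat (qj i) | i <- iota 0 D] ++ [:: hat (pj j) * hat (qj j)]).
(* Elements of B0 evaluate to real constants, whose signs phi preserves. *)
have [|a Ha] := HL K Rreal (phi \o inc) evc.
  move=> b _; apply: phi_cst => x _.
  by rewrite /ev /inc ieval_cst /evl ieval_cst.
pose z : Rn n := fun i => a (fin_index i).
have zq i : (i < D)%N -> samesign (Q i, peval (qj i) z).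
  move=> iD; have := Ha (hat (qj i)); rewrite evl_hat; last exact: subq.
  by apply; rewrite mem_cat map_f // mem_iota.
have zlow i : (i < j)%N -> peval (qj i) z = 0.
  move=> ij; apply/eqP; have := samesign_eq0 (zq i (ltn_trans ij jD)).
  by rewrite /= Qlow // eqxx => <-.
have zpq : peval (pj j) z * peval (qj j) z < 0.
  have := Ha (hat (pj j) * hat (qj j)); rewrite mem_cat inE eqxx orbT => /(_ isT) /samesign_lt0 /=.
  by rewrite !rmorphM !evl_hat ?PQneg => [<-||]; [|exact: subq|exact: subp].
have := strata fcont q0 fE zlow; rewrite -/(qj j) -/(pj j) => E.
by move: zpq; rewrite -E -mulrA ltNge mulr_ge0 // -expr2 sqr_ge0.
Qed.

End Certificate.

Local Close Scope ring_scope.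
Local Close Scope classical_set_scope.

Theorem theorem6p2 (n : nat) (hn : (1 <= n)%coq_nat) (f : Rn n -> R)
  (hf : regulous f) (hpos : forall x : Rn n, 0 <= f x) :
  exists fs : list (Rn n -> R),
    List.Forall (fun g => regulous g) fs /\ (forall x : Rn n, f x = sum_sq fs x).
Proof.
case: hf => /contP fcont [S [p [q [[x0 Sx0] fE]]]].
have [f0|/existsNP[x1 fx1]] := pselect (forall x, f x = 0).
  by exists nil; split; [constructor|].
(* Multiplying p and q by one polynomial g of S, nonzero at x0, makes f q = p valid wherever the new
   denominator is nonzero. *)
have [g gS gx0] : exists2 g, List.In g S & peval g x0 <> 0.
  by apply: contrapT => H; apply: Sx0 => g gS; apply: contrapT => gx; apply: H; exists g.
have Sx x : peval g x <> 0 -> zariski_open_of S x by move=> gx H; apply: gx; exact: H.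
have f0 x : (0 <= f x)%R by apply/RleP; exact: hpos.
have pos : (0 < f x1)%R by rewrite lt_neqAle f0 andbT eq_sym; apply/eqP.
have qx0 : (peval (PMul g q) x0 != 0)%R.
  by rewrite /= RmultE mulf_neq0 //; apply/eqP => //; have [] := fE x0 (Sx _ gx0).
have E x : (peval (PMul g q) x != 0 -> f x * peval (PMul g q) x = peval (PMul g p) x)%R.
  rewrite /= !RmultE mulf_eq0 negb_or => /andP[/eqP gx /eqP qx].
  have [_ ->] := fE x (Sx _ gx); rewrite RdivE mulrCA; congr (_ * _)%R.
  by rewrite divfK //; apply/eqP.
have [s [t [Ss St cert]]] := certificate fcont qx0 E f0 pos.
exact: (regulous_of_certificate fcont qx0 E f0 pos Ss St cert).
Qed.
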